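(* Fix $r\in(0,\infty)$. Let $(s_n)$ be a sequence of integers with $1\le s_n\le n$, and put $\eta_n=s_n/n$. If $s_n\to\infty$ and $s_n/n\to0$ as $n\to\infty$, then the product bi-grid prior $\pi_{\mathsf B,n}(d\boldsymbol\theta)=\prod_{i=1}^n\pi_{\mathsf B}[\eta_n](d\theta_i)$ satisfies $$B(\pi_{\mathsf B,n})=R_N(\Theta_n[s_n])\cdot(1+o(1)).$$
   Context: Model: $\boldsymbol X\sim N_n(\boldsymbol\theta,\boldsymbol I)$ and $\boldsymbol Y\sim N_n(\boldsymbol\theta,r\boldsymbol I)$ are independent given the unknown $\boldsymbol\theta\in\mathbb R^n$; $r>0$ is known and fixed. Put $v=(1+r^{-1})^{-1}=r/(1+r)$. Let $p(\boldsymbol x|\boldsymbol\theta,1)$ and $p(\boldsymbol y|\boldsymbol\theta,r)$ denote the Gaussian densities of $\boldsymbol X$ and $\boldsymbol Y$. A predictive density estimator $\hat p(\boldsymbol y|\boldsymbol x)$ is, for each $\boldsymbol x\in\mathbb R^n$, a probability density in $\boldsymbol y\in\mathbb R^n$ (jointly measurable). Its Kullback–Leibler loss is $L(\boldsymbol\theta,\hat p(\cdot|\boldsymbol x))=\int p(\boldsymbol y|\boldsymbol\theta,r)\log\frac{p(\boldsymbol y|\boldsymbol\theta,r)}{\hat p(\boldsymbol y|\boldsymbol x)}\,d\boldsymbol y$ and its risk is $\rho(\boldsymbol\theta,\hat p)=\int L(\boldsymbol\theta,\hat p(\cdot|\boldsymbol x))\,p(\boldsymbol x|\boldsymbol\theta,1)\,d\boldsymbol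 x$. For a prior $\pi$ on $\mathbb R^n$, the integrated risk is $B(\pi,\hat p)=\int\rho(\boldsymbol\theta,\hat p)\,\pi(d\boldsymbol\theta)$ and the Bayes risk is $B(\pi)=\inf_{\hat p}B(\pi,\hat p)$, the infimum being over all predictive density estimators. Let $\|\boldsymbol\theta\|_0=\#\{i:\theta_i\ne0\}$, $\Theta_n[s]=\{\boldsymbol\theta\in\mathbb R^n:\|\boldsymbol\theta\|_0\le s\}$, and $R_N(\Theta)=\inf_{\hat p}\sup_{\boldsymbol\theta\in\Theta}\rho(\boldsymbol\theta,\hat p)$, the infimum being over all predictive density estimators. Bi-grid prior: let $b=\min\{4r(1+r)(1+2r)^{-1},1\}$ and $K=1+\lceil 2b^{-3/2}\rceil$. For $\eta\in(0,1)$ let $\lambda=\lambda(\eta)=\sqrt{2\log\eta^{-v}}$, $\nu_k=\lambda+(k-1)b\lambda$ for $k=1,\dots,K$, and $\mu_j=\nu_K+j\lambda$ for $j=1,2,\dots$. Let $$\nu_{\mathsf B}^+=c\Bigl[\sum_{k=1}^K\eta^{(k-1)vb^2}\delta_{\nu_k}+\eta^{(K-1)vb^2}\sum_{j=1}^\infty\eta^{jv}\delta_{\mu_j}\Bigr],$$ where $c=c(\eta)>0$ is the normalizing constant making $\nu_{\mathsf B}^+$ a probability measure and $\delta_a$ is the unit point mass at $a$. Let $\nu_{\mathsf B}^-$ be the reflection of $\nu_{\mathsf B}^+$ about $0$ and $\pi_{\mathsf B}[\eta]=(1-\eta)\delta_0+\tfrac12\eta(\nu_{\mathsf B}^++\nu_{\mathsf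 B}^-)$. *)

(* Defs.v *)
From HB Require Import structures.
From mathcomp Require Import all_boot all_order all_algebra.
From mathcomp Require Import all_classical all_reals all_analysis.

Set Implicit Arguments.
Unset Strict Implicit.
Unset Printing Implicit Defensive.

Import Order.TTheory GRing.Theory Num.Theory.
Import numFieldNormedType.Exports.

Local Open Scope classical_set_scope.
Local Open Scope ring_scope.

Section measure_power.
Context d (T : measurableType d) (R : realType).

Definition tuple_cons n (z : T * n.-tuple T) : n.+1.-tuple T :=
  [tuple of z.1 :: z.2].

(* The n-fold product measure mu^n on T^n, T^n carrying the product
   sigma-algebra; for n = 0 it is the unit mass at the empty tuple. *)
Fixpoint measure_power (mu : set T -> \bar R) (n : nat) :
    set (n.-tuple T) -> \bar R :=
  match n with
  | 0 => \d_([tuple] : 0.-tuple T)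
  | m.+1 => pushforward (mu \x @measure_power mu m)%E (@tuple_cons m)
  end.

End measure_power.
Arguments measure_power {d T R} mu n.

Section prediction.
Context {R : realType}.
Implicit Types (r : R) (n : nat).

Definition lebesgue_Rn n : set (n.-tuple R) -> \bar R :=
  measure_power (@lebesgue_measure R) n.
Arguments lebesgue_Rn : clear implicits.

(* Density at y of N_n(theta, w I); normal_pdf takes the standard deviation. *)
Definition gaussian_pdf n (w : R) (theta y : n.-tuple R) : R :=
  \prod_(i < n) normal_pdf (tnth theta i) (Num.sqrt w) (tnth y i).

Definition predictive_density n (phat : n.-tuple R -> n.-tuple R -> R) : Prop :=
  [/\ forall x y, 0 <= phat x y,
      measurable_fun setT (fun z : n.-tuple R * n.-tuple R => phat z.1 z.2) &
      forall x, (\int[lebesgue_Rn n]_y (phat x y)%:E = 1)%E].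

(* Division and logarithm are those of \bar R: the integrand is +oo where q
   vanishes. *)
Definition KL_loss r n (theta : n.-tuple R) (q : n.-tuple R -> R) : \bar R :=
  (\int[lebesgue_Rn n]_y
     ((gaussian_pdf r theta y)%:E *
      lne ((gaussian_pdf r theta y)%:E / (q y)%:E)))%E.

Definition risk r n (theta : n.-tuple R)
    (phat : n.-tuple R -> n.-tuple R -> R) : \bar R :=
  (\int[lebesgue_Rn n]_x
     (KL_loss r theta (phat x) * (gaussian_pdf 1 theta x)%:E))%E.

Definition integrated_risk r n (prior : set (n.-tuple R) -> \bar R)
    (phat : n.-tuple R -> n.-tuple R -> R) : \bar R :=
  (\int[prior]_theta risk r theta phat)%E.

Definition bayes_risk r n (prior : set (n.-tuple R) -> \bar R) : \bar R :=
  ereal_inf [set integrated_risk r prior phat |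
             phat in @predictive_density n].

Definition minimax_risk r n (Theta : set (n.-tuple R)) : \bar R :=
  ereal_inf [set ereal_sup [set risk r theta phat | theta in Theta] |
             phat in @predictive_density n].

Definition l0norm n (theta : n.-tuple R) : nat :=
  #|[pred i | tnth theta i != 0]|.

Definition sparse n (s : nat) : set (n.-tuple R) :=
  [set theta | (l0norm theta <= s)%N].

End prediction.
Arguments lebesgue_Rn {R} n.
Arguments sparse {R} n s.

Section bigrid.
Context {R : realType}.
Implicit Types (r eta : R) (k j : nat) (A : set R).

Definition bg_v r : R := (1 + r^-1)^-1.

Definition bg_b r : R := Num.min (4 * r * (1 + r) * (1 + 2 * r)^-1) 1.

(* The ceiling is a positive integer when r > 0, so absz only casts it. *)
Definition bg_K r : nat := (1 + `|Num.ceil (2 * bg_b r `^ (- (3 / 2)))|)%N.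

Definition bg_lambda r eta : R := Num.sqrt (2 * ln (eta `^ (- bg_v r))).

Definition bg_nu r eta k : R :=
  bg_lambda r eta + (k%:R - 1) * bg_b r * bg_lambda r eta.

Definition bg_mu r eta j : R :=
  bg_nu r eta (bg_K r) + j%:R * bg_lambda r eta.

Definition bigrid_unnormalized r eta A : \bar R :=
  (\sum_(1 <= k < (bg_K r).+1)
      (eta `^ ((k%:R - 1) * bg_v r * bg_b r ^+ 2))%:E *
      \d_(bg_nu r eta k) A +
   (eta `^ (((bg_K r)%:R - 1) * bg_v r * bg_b r ^+ 2))%:E *
   \sum_(1 <= j <oo)
      (eta `^ (j%:R * bg_v r))%:E * \d_(bg_mu r eta j) A)%E.

Definition bigrid_pos r eta A : \bar R :=
  ((fine (bigrid_unnormalized r eta setT))^-1%:E *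
   bigrid_unnormalized r eta A)%E.

Definition bigrid_neg r eta : set R -> \bar R :=
  pushforward (bigrid_pos r eta) -%R.

Definition bigrid_prior r eta A : \bar R :=
  ((1 - eta)%:E * \d_(0%R : R) A +
   (2^-1 * eta)%:E * (bigrid_pos r eta A + bigrid_neg r eta A))%E.

End bigrid.

(* Main.v *)
(* Put L = ln (n / s) and v = r / (1 + r); both risks are s L (1 - v) (1 + o(1)).

   Upper bounds.  The Bayes predictive density of the improper prior
   delta_0 + e^-L Lebesgue is an explicit mixture of N(0, r) and N(x, 1 + r).
   In one dimension its risk is O(e^-L sqrt L) at 0 and, for every d > 0, at
   most (1 - v + d) L + C uniformly in the mean.  Risks of product estimators
   add up over coordinates.

   Lower bounds.  Let Q be the Bayes predictive density of a product prior
   pi^n.  Applying ln u <= u - 1 to u = phat / Q gives, for every estimator phat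
   and every measurable S,
     int_S risk(theta, Q) dpi^n <= int_S risk(theta, phat) dpi^n + 1.
   The bi-grid prior gives mass eta (1 + o(1)) to {lambda, -lambda}, and there
   the one-dimensional Bayes risk is at least (1 - v - d) L - C: the
   log-likelihood ratio against 0 is about v L for x alone but about L, the log
   of the inverse prior mass, for the pair (x, y).  The choice S = R^n bounds
   the Bayes risk.  For the minimax risk take S the set of s-sparse vectors and
   the bi-grid prior of the slightly smaller sparsity (1 - e) s / n: Chebyshev's
   inequality shows that little is lost outside S. *)
From HB Require Import structures.
Require Import Defs.
From mathcomp Require Import all_boot all_order all_algebra.
From mathcomp Require Import all_classical all_reals all_analysis.
From mathcomp Require Import measurable_realfun.
From mathcomp Require Import ring lra.
Import Order.TTheory GRing.Theory Num.Theory.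
Import numFieldNormedType.Exports.
Set Implicit Arguments.
Unset Strict Implicit.
Unset Printing Implicit Defensive.
Local Open Scope classical_set_scope.
Local Open Scope ring_scope.

(** * Product measures on tuples *)

(** The threshold behind both rates is [a ^+ 2 = 2 v L]. Since [1 + r^-1 = v^-1], the log-likelihood
    ratio of a mean [a] against 0 is about [a ^+ 2 / 2] for [x] and [a ^+ 2 / (2 v)] for the pair,
    that is, [v L] and [L] at the threshold. Below it, predicting with N(0, r) costs about
    [a ^+ 2 / (2 r) <= (1 - v) L]. Above it, the odds of the null component against the flat one are
    about [exp (L - a ^+ 2 / 2)], so relying on the flat one costs about
    [L - a ^+ 2 / 2 <= (1 - v) L]. [bg_lambda] lies exactly on the threshold, where upper and lower
    bounds meet. The additive 1 of the lower bound is paid once for the whole vector and not once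
    per coordinate, which makes it negligible against [s L]. It survives the restriction to [S]
    because the error term is nonnegative. The obstacle throughout is that risks may be infinite and
    that logarithmic integrands change sign. Inequalities are therefore arranged with subtracted
    terms moved to the other side, so that only nonnegative functions are integrated. *)

Section measure_power_theory.
Context d (T : measurableType d) (R : realType).
Local Open Scope ereal_scope.
Implicit Types mu : {sigma_finite_measure set T -> \bar R}.

Lemma measurable_tuple_cons n :
  measurable_fun [set: T * n.-tuple T] (@tuple_cons d T n).
Proof. exact: measurable_cons. Qed.

(** [measure_power] is a bare set function; the induction gives it a measure structure. Each stage
    is the pushforward of a product along the bijection [tuple_cons], so rectangles of finite
    measure, pulled back along its inverse [uncons], exhaust the space. *)
Lemma measure_power_sigma_finite mu n :
  {nu : {sigma_finite_measure set (n.-tuple T) -> \bar R} |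
    nu = measure_power mu n :> (set (n.-tuple T) -> \bar R)}.
Proof.
elim: n => [|n [nu nuE]]; first by exists \d_([tuple] : 0.-tuple T).
have mc := @measurable_tuple_cons n.
pose M : {measure set (n.+1.-tuple T) -> \bar R} :=
  measure_function_pushforward__canonical__measure_function_Measure (mu \x nu) mc.
have sf : sigma_finite setT M.
  have /sigma_finiteP[F [TF ndF Foo]] := sigma_finiteT mu.
  have /sigma_finiteP[G [TG ndG Goo]] := sigma_finiteT nu.
  pose uncons (t : n.+1.-tuple T) := (thead t, [tuple of behead t]).
  have muncons : measurable_fun setT uncons.
    apply/measurable_fun_pairP; split; last exact: measurable_behead.
    exact: measurable_tnth.
  have consK : cancel (@tuple_cons d T n) uncons.
    by case=> x t; congr pair; apply/val_inj.
  exists (fun k => uncons @^-1` (F k `*` G k)).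
    apply/seteqP; split => // t _; rewrite -preimage_bigcup.
    have [i _ Fi] : (\bigcup_i F i) (uncons t).1 by rewrite -TF.
    have [j _ Gj] : (\bigcup_j G j) (uncons t).2 by rewrite -TG.
    (* Both covers are nondecreasing, so the larger index serves both factors. *)
    exists (maxn i j) => //; split.
      by move: Fi; exact/subsetPset/ndF/leq_maxl.
    by move: Gj; exact/subsetPset/ndG/leq_maxr.
  move=> k; have [mF Fk] := Foo k; have [mG Gk] := Goo k.
  split.
    by rewrite -[X in measurable X]setTI; apply: muncons => //; exact: measurableX.
  rewrite /M /= /pushforward -comp_preimage (_ : uncons \o _ = id); last exact/funext.
  by rewrite preimage_id product_measure1E// lte_mul_pinfty// ge0_fin_numE.
pose S : {sigma_finite_measure set (n.+1.-tuple T) -> \bar R} :=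
  HB.pack (Measure.sort M) (Measure.class M) (Measure_isSigmaFinite.Build _ _ _ M sf).
exists S.
by rewrite /= -nuE.
Qed.

Definition mpow mu n : {sigma_finite_measure set (n.-tuple T) -> \bar R} :=
  sval (measure_power_sigma_finite mu n).

Lemma mpowE mu n : measure_power mu n = mpow mu n.
Proof. by rewrite /mpow; case: measure_power_sigma_finite. Qed.

Lemma integral_mpow0 mu (f : 0.-tuple T -> \bar R) :
  measurable_fun setT f -> (forall t, 0 <= f t) ->
  \int[mpow mu 0]_t f t = f [tuple].
Proof.
move=> mf f0; rewrite -mpowE /= integral_dirac//.
by rewrite diracE in_setT mul1e.
Qed.

Lemma integral_mpowS mu n (f : n.+1.-tuple T -> \bar R) :
  measurable_fun setT f -> (forall t, 0 <= f t) ->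
  \int[mpow mu n.+1]_t f t =
  \int[mu]_x \int[mpow mu n]_t f [tuple of x :: t].
Proof.
move=> mf f0; rewrite -mpowE /= mpowE.
have mc := @measurable_tuple_cons n.
rewrite ge0_integral_pushforward//.
rewrite preimage_setT fubini_tonelli1//.
  by apply: measurableT_comp.
by move=> z; exact: f0.
Qed.

End measure_power_theory.

(** * Relative entropy *)

Section relative_entropy_integrand.
Context {R : realType}.
Implicit Types p q : R.

(* The correction [q - p] integrates to 0 for densities and makes the integrand
   nonnegative, so that Tonelli's theorem applies throughout; [ln 0] is [0],
   hence the separate case. *)
Definition kl_integrand p q : \bar R :=
  if q == 0 then +oo%E else (p * (ln p - ln q) + q - p)%:E.

Lemma ln_ub_sub1 (u : R) : 0 < u -> ln u <= u - 1.
Proof. by move=> u0; have := @le_ln1Dx R (u - 1); rewrite subrKC; apply; lra. Qed.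

(** Written with sums only, so that it holds at [q = 0] too, where both sides are [+oo]. *)
Lemma kl_integrandE p q : 0 < p -> 0 <= q ->
  (kl_integrand p q + p%:E = p%:E * lne (p%:E / q%:E) + q%:E)%E.
Proof.
move=> p0 q0; rewrite /kl_integrand; case: eqP => [->|/eqP qn0].
  rewrite inve0 gt0_muley ?lte_fin//=.
  by rewrite gt0_muley ?lte_fin.
have q1 : 0 < q by rewrite lt0r qn0.
rewrite inver (negbTE qn0) -EFinM lne_EFin ?divr_gt0// ln_div ?posrE//.
by rewrite -!EFinM -!EFinD; congr EFin; ring.
Qed.

Lemma kl_integrand_ge0 p q : 0 < p -> 0 <= q -> (0 <= kl_integrand p q)%E.
Proof.
move=> p0 q0; rewrite /kl_integrand; case: eqP => [_|/eqP qn0]; first exact: leey.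
have q1 : 0 < q by rewrite lt0r qn0.
rewrite lee_fin.
have := @ln_ub_sub1 (q / p) (divr_gt0 q1 p0).
rewrite ln_div ?posrE// => H.
have : p * (ln q - ln p) <= p * (q / p - 1) by rewrite ler_pM2l.
by rewrite [leRHS]mulrBr (mulrC p (q / p)) divfK ?gt_eqF//; lra.
Qed.

Lemma measurable_fun_ln d (T : measurableType d) (f : T -> R) :
  measurable_fun setT f -> measurable_fun setT (fun x => ln (f x)).
Proof. by move=> mf; apply: measurableT_comp => //; exact: measurable_ln. Qed.

Lemma measurable_kl_integrand d (T : measurableType d) (p q : T -> R) :
  measurable_fun setT p -> measurable_fun setT q ->
  measurable_fun setT (fun x => kl_integrand (p x) (q x)).
Proof.
move=> mp mq; rewrite /kl_integrand.
apply: measurable_fun_ifT => //.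
  apply: (measurable_fun_bool true).
  rewrite (_ : _ @^-1` _ = q @^-1` [set 0]).
    by apply: mq => //; exact: measurable_set1.
  by apply/seteqP; split => x /= /eqP.
apply/measurable_EFinP.
apply: measurable_funB => //; apply: measurable_funD => //.
apply: measurable_funM => //; apply: measurable_funB.
  exact: measurable_fun_ln.
exact: measurable_fun_ln.
Qed.

Local Open Scope ereal_scope.

(** The two integrands differ by [p - q], whose integral is 0, but the common value may be [+oo].
    Nonnegativity of [kl_integrand] bounds the negative part of the logarithmic integrand by [q],
    which is integrable, so only the positive part can be infinite. *)
Lemma integral_kl_integrand d (T : measurableType d) (mu : {measure set T -> \bar R})
    (p q : T -> R) :
  measurable_fun setT p -> measurable_fun setT q ->
  (forall x, 0 < p x)%R -> (forall x, 0 <= q x)%R ->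
  \int[mu]_x (p x)%:E = 1 -> \int[mu]_x (q x)%:E = 1 ->
  \int[mu]_x ((p x)%:E * lne ((p x)%:E / (q x)%:E)) =
  \int[mu]_x kl_integrand (p x) (q x).
Proof.
move=> mp mq p0 q0 p1 q1.
set f := fun x => (p x)%:E * lne ((p x)%:E / (q x)%:E).
have fE x : f x = kl_integrand (p x) (q x) + (p x - q x)%:E.
  by rewrite EFinB addeA (kl_integrandE (p0 x) (q0 x)) addeK.
have mh := measurable_kl_integrand mp mq.
have mf : measurable_fun setT f.
  apply: (eq_measurable_fun (fun x => kl_integrand (p x) (q x) + (p x - q x)%:E)).
    by move=> x _; rewrite fE.
  by apply: emeasurable_funD => //; apply/measurable_EFinP/measurable_funB.
have h0 x := kl_integrand_ge0 (p0 x) (q0 x).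
have mpE : measurable_fun setT (fun x => (p x)%:E) by exact/measurable_EFinP.
have mqE : measurable_fun setT (fun x => (q x)%:E) by exact/measurable_EFinP.
have ple x : 0 <= (p x)%:E by rewrite lee_fin ltW.
have fneg : \int[mu]_x f^\- x \is a fin_num.
  rewrite ge0_fin_numE ?integral_ge0//.
  apply: (@le_lt_trans _ _ 1); last exact: ltry.
  rewrite -q1; apply: ge0_le_integral => //.
  - exact: measurable_funeneg.
  - move=> x _; rewrite funenegE ge_max lee_fin q0 andbT fE.
    have := h0 x; case: (kl_integrand _ _) => [a| |]//.
      by rewrite -EFinD -EFinN !lee_fin => ?; have := p0 x; lra.
    by rewrite addye// leNye.
(* The left 1 stands for the integral of [q], the right one for that of [p]: pointwise,
   [f^+ + q = kl_integrand p q + p + f^-], and all five terms are nonnegative. *)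
have E : \int[mu]_x f^\+ x + 1 = \int[mu]_x kl_integrand (p x) (q x) + 1 + \int[mu]_x f^\- x.
  have mfp := measurable_funepos mf; have mfn := measurable_funeneg mf.
  have mhp : measurable_fun setT (fun x => kl_integrand (p x) (q x) + (p x)%:E).
    exact: emeasurable_funD.
  have qge x (_ : [set: T] x) : 0 <= (q x)%:E by rewrite lee_fin.
  have hpge x (_ : [set: T] x) : 0 <= kl_integrand (p x) (q x) + (p x)%:E.
    by rewrite adde_ge0.
  rewrite -[in LHS]q1 -[in RHS]p1 -!ge0_integralD//.
  apply: eq_integral => x _.
  rewrite funeposE funenegE fE; have := h0 x; have := q0 x; have := p0 x.
  case: (kl_integrand _ _) => [a| |]// px qx.
    rewrite lee_fin -!EFinD => a0; rewrite -EFinN -!EFin_max -!EFinD; congr EFin.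
    have [ge|lt] := leP 0%R (a + (p x - q x))%R.
      by rewrite max_r; lra.
    by rewrite max_l; lra.
  move=> _; have -> : +oo + (p x - q x)%:E = +oo by [].
  have -> : maxe +oo 0 = +oo :> \bar R by apply/max_idPl; exact: leey.
  have -> : maxe (- +oo) 0 = 0 :> \bar R by apply/max_idPr; exact: leNye.
  by rewrite adde0.
have E' : \int[mu]_x f^\+ x = \int[mu]_x kl_integrand (p x) (q x) + \int[mu]_x f^\- x.
  have one_fin : (1 : \bar R) \is a fin_num by [].
  by rewrite -[LHS](addeK _ one_fin) E addeAC addeK.
by rewrite integralE E' addeK.
Qed.

End relative_entropy_integrand.

(** * Integrals over product measures *)

Section integral_wrappers.
Context d (T : measurableType d) (R : realType) (mu : {measure set T -> \bar R}).
Local Open Scope ereal_scope.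
Implicit Types f g : T -> \bar R.

Lemma ge0_integralTD f g : (forall x, 0 <= f x) -> (forall x, 0 <= g x) ->
  measurable_fun setT f -> measurable_fun setT g ->
  \int[mu]_x (f x + g x) = \int[mu]_x f x + \int[mu]_x g x.
Proof. by move=> *; apply: ge0_integralD. Qed.

Lemma ge0_integralTZl f k : (forall x, 0 <= f x) -> 0 <= k ->
  measurable_fun setT f -> \int[mu]_x (k * f x) = k * \int[mu]_x f x.
Proof. by move=> *; apply: ge0_integralZl. Qed.

Lemma ge0_integralTZr f k : (forall x, 0 <= f x) -> 0 <= k ->
  measurable_fun setT f -> \int[mu]_x (f x * k) = \int[mu]_x f x * k.
Proof. by move=> *; apply: ge0_integralZr. Qed.

Lemma ge0_le_integralT f g : (forall x, 0 <= f x) ->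
  measurable_fun setT f -> measurable_fun setT g -> (forall x, f x <= g x) ->
  \int[mu]_x f x <= \int[mu]_x g x.
Proof. by move=> *; apply: ge0_le_integral. Qed.

End integral_wrappers.

Section measurability.
Context d (T : measurableType d) (R : realType).

Lemma measurable_fun_tnth d' (Z : measurableType d') n (a : Z -> n.-tuple T)
    (i : 'I_n) :
  measurable_fun setT a -> measurable_fun setT (fun z => tnth (a z) i).
Proof.
by move=> ma; apply: (measurableT_comp (@measurable_tnth _ T n i) ma).
Qed.

Lemma measurable_fun_expR (f : T -> R) :
  measurable_fun setT f -> measurable_fun setT (fun x => expR (f x)).
Proof. by move=> mf; apply: measurableT_comp => //; exact: measurable_expR. Qed.

Lemma measurable_fun_inv (f : T -> R) : (forall x, 0 < f x) ->
  measurable_fun setT f -> measurable_fun setT (fun x => (f x)^-1).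
Proof.
move=> f0 mf; apply: (eq_measurable_fun (fun x => expR (- ln (f x)))).
  by move=> x _; rewrite expRN lnK ?posrE.
by apply: measurable_fun_expR; apply: measurableT_comp => //; exact: measurable_fun_ln.
Qed.

Lemma measurable_fun_prod_ord n (f : 'I_n -> T -> R) :
  (forall i, measurable_fun setT (f i)) ->
  measurable_fun setT (fun x => \prod_(i < n) f i x).
Proof. by move=> mf; apply: measurable_prod => i _. Qed.

Lemma measurable_integral2 d' (Z : measurableType d')
    (mu : {sigma_finite_measure set Z -> \bar R}) (f : T -> Z -> \bar R) :
  measurable_fun setT (fun z : T * Z => f z.1 z.2) ->
  (forall x y, 0 <= f x y)%E ->
  measurable_fun setT (fun x => \int[mu]_y f x y)%E.
Proof.
move=> mf f0.
exact: (measurable_fun_fubini_tonelli_F (fun z : T * Z => f z.1 z.2)).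
Qed.

End measurability.

Lemma measurable_fun_comp2 d1 d2 d3 d4 (X1 : measurableType d1)
    (X2 : measurableType d2) (Y : measurableType d3) (Z : measurableType d4)
    (F : X1 -> X2 -> Y) (f : Z -> X1) (g : Z -> X2) :
  measurable_fun setT (fun z : X1 * X2 => F z.1 z.2) ->
  measurable_fun setT f -> measurable_fun setT g ->
  measurable_fun setT (fun z => F (f z) (g z)).
Proof.
move=> mF mf mg.
exact: (measurableT_comp mF (measurable_fun_pair mf mg)).
Qed.

Section product_integrals.
Context d (T : measurableType d) (R : realType).
Variable mu : {sigma_finite_measure set T -> \bar R}.
Local Open Scope ereal_scope.

Lemma measurable_tprod n (F : 'I_n -> T -> R) :
  (forall i, measurable_fun setT (F i)) ->
  measurable_fun setT (fun t : n.-tuple T => \prod_(i < n) F i (tnth t i))%R.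
Proof.
move=> mF; apply: measurable_fun_prod_ord => i.
by apply: measurableT_comp => //; exact: measurable_tnth.
Qed.

Lemma prod_tuple_cons n (F : 'I_n.+1 -> T -> R) x (t : n.-tuple T) :
  (\prod_(i < n.+1) F i (tnth [tuple of x :: t] i) =
   F ord0 x * \prod_(i < n) F (lift ord0 i) (tnth t i))%R.
Proof.
by rewrite big_ord_recl tnth0; congr *%R; apply: eq_bigr => i _; rewrite tnthS.
Qed.

Lemma integral_tprod n (F : 'I_n -> T -> R) :
  (forall i, measurable_fun setT (F i)) -> (forall i x, 0 <= F i x)%R ->
  (forall i, \int[mu]_x (F i x)%:E = 1) ->
  \int[mpow mu n]_t (\prod_(i < n) F i (tnth t i))%:E = 1.
Proof.
elim: n F => [|n IH] F mF F0 F1.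
  rewrite integral_mpow0 ?big_ord0//.
    by apply/measurable_EFinP; exact: measurable_tprod mF.
  by move=> t; rewrite lee_fin prodr_ge0.
rewrite integral_mpowS; first last.
  by move=> t; rewrite lee_fin prodr_ge0.
  by apply/measurable_EFinP; exact: measurable_tprod mF.
rewrite -(F1 ord0); apply: eq_integral => x _.
under eq_integral do rewrite prod_tuple_cons EFinM.
rewrite ge0_integralTZl ?lee_fin//.
- by rewrite (IH (fun i => F (lift ord0 i)))// mule1.
- by move=> t; rewrite lee_fin prodr_ge0.
- by apply/measurable_EFinP; exact: measurable_tprod (fun i => mF (lift ord0 i)).
Qed.

(** By Tonelli, every factor other than the [i]-th integrates to 1. The function [f] is
    extended-valued because it will be a relative entropy. *)
Lemma integral_tprod_marginal n (F : 'I_n -> T -> R) (f : T -> \bar R) i :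
  (forall i, measurable_fun setT (F i)) -> (forall i x, 0 <= F i x)%R ->
  (forall i, \int[mu]_x (F i x)%:E = 1) ->
  measurable_fun setT f -> (forall x, 0 <= f x) ->
  \int[mpow mu n]_t (f (tnth t i) * (\prod_(j < n) F j (tnth t j))%:E) =
  \int[mu]_x (f x * (F i x)%:E).
Proof.
elim: n F i => [|n IH] F i mF F0 F1 mf f0; first by case: i.
have mP : measurable_fun setT
    (fun t : n.-tuple T => (\prod_(j < n) F (lift ord0 j) (tnth t j))%:E).
  by apply/measurable_EFinP; exact: measurable_tprod (fun i => mF (lift ord0 i)).
have P0 (t : n.-tuple T) : 0 <= (\prod_(j < n) F (lift ord0 j) (tnth t j))%:E.
  by rewrite lee_fin prodr_ge0.
rewrite integral_mpowS; first last.
  by move=> t; rewrite mule_ge0// lee_fin prodr_ge0.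
  apply: emeasurable_funM; last by apply/measurable_EFinP; exact: measurable_tprod mF.
  by apply: measurableT_comp => //; exact: measurable_tnth.
have [->|i0] := eqVneq i ord0.
  apply: eq_integral => x _.
  under eq_integral do rewrite prod_tuple_cons tnth0 EFinM muleA.
  rewrite ge0_integralTZl ?mule_ge0 ?lee_fin//.
  by rewrite (integral_tprod (F := fun i => F (lift ord0 i)))// mule1.
have [j ->] : exists j, i = lift ord0 j.
  by case: (unliftP ord0 i) i0 => [j ->|->]; [exists j|rewrite eqxx].
rewrite -(IH (fun i => F (lift ord0 i)) j)//.
under eq_integral => x _.
  under eq_integral do rewrite prod_tuple_cons tnthS EFinM muleCA.
  rewrite ge0_integralTZl ?lee_fin//; first over.
    by move=> t; rewrite mule_ge0.
  apply: emeasurable_funM => //.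
  by apply: measurableT_comp => //; exact: measurable_tnth.
rewrite ge0_integralTZr ?F1 ?mul1e//.
- by move=> x; rewrite lee_fin.
- by apply: integral_ge0 => t _; rewrite mule_ge0.
- exact/measurable_EFinP.
Qed.

(** Relative entropy is additive over independent coordinates. The correction term of [kl_integrand]
    is not additive pointwise; the discrepancy vanishes only after integration. *)
Lemma integral_kl_integrand_tprod n (P Q : 'I_n -> T -> R) :
  (forall i, measurable_fun setT (P i)) -> (forall i, measurable_fun setT (Q i)) ->
  (forall i x, 0 < P i x)%R -> (forall i x, 0 < Q i x)%R ->
  (forall i, \int[mu]_x (P i x)%:E = 1) -> (forall i, \int[mu]_x (Q i x)%:E = 1) ->
  \int[mpow mu n]_t kl_integrand (\prod_(i < n) P i (tnth t i)) (\prod_(i < n) Q i (tnth t i)) =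
  \sum_(i < n) \int[mu]_x kl_integrand (P i x) (Q i x).
Proof.
elim: n P Q => [|n IH] P Q mP mQ P0 Q0 P1 Q1.
  have -> : (fun t : 0.-tuple T => kl_integrand (\prod_(i < 0) P i (tnth t i))
     (\prod_(i < 0) Q i (tnth t i))) = cst 0.
    apply/funext => t; rewrite !big_ord0 /kl_integrand oner_eq0.
    by rewrite ln1 subrr mulr0 add0r subrr.
  by rewrite integral0 big_ord0.
set P' := fun i => P (lift ord0 i); set Q' := fun i => Q (lift ord0 i).
rewrite big_ord_recl -(IH P' Q' (fun=> mP _) (fun=> mQ _) (fun=> P0 _) (fun=> Q0 _)
  (fun=> P1 _) (fun=> Q1 _)).
pose p (t : n.-tuple T) := (\prod_(i < n) P' i (tnth t i))%R.
pose q (t : n.-tuple T) := (\prod_(i < n) Q' i (tnth t i))%R.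
have mp : measurable_fun setT p := measurable_tprod (fun i => mP (lift ord0 i)).
have mq : measurable_fun setT q := measurable_tprod (fun i => mQ (lift ord0 i)).
have p0 t : (0 < p t)%R by apply: prodr_gt0 => i _; exact: P0.
have q0 t : (0 < q t)%R by apply: prodr_gt0 => i _; exact: Q0.
have p1 : \int[mpow mu n]_t (p t)%:E = 1.
  by apply: integral_tprod => [i|i x|i]; [exact: mP|apply/ltW; exact: P0|exact: P1].
have q1 : \int[mpow mu n]_t (q t)%:E = 1.
  by apply: integral_tprod => [i|i x|i]; [exact: mQ|apply/ltW; exact: Q0|exact: Q1].
have mPt : measurable_fun setT
    (fun t : n.+1.-tuple T => \prod_(i < n.+1) P i (tnth t i))%R := measurable_tprod mP.
have mQt : measurable_fun setT
    (fun t : n.+1.-tuple T => \prod_(i < n.+1) Q i (tnth t i))%R := measurable_tprod mQ.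
rewrite integral_mpowS; first last.
  by move=> t; apply: kl_integrand_ge0; [|apply/ltW]; apply: prodr_gt0 => i _.
  exact: measurable_kl_integrand.
set H1 := \int[mu]_x kl_integrand (P ord0 x) (Q ord0 x).
set H2 := \int[mpow mu n]_t kl_integrand (p t) (q t).
have m1 : measurable_fun setT (fun x => kl_integrand (P ord0 x) (Q ord0 x)).
  exact: measurable_kl_integrand.
have m2 : measurable_fun setT (fun t => kl_integrand (p t) (q t)) by exact: measurable_kl_integrand.
have h1 x : 0 <= kl_integrand (P ord0 x) (Q ord0 x) by apply: kl_integrand_ge0 => //; exact: ltW.
have h2 t : 0 <= kl_integrand (p t) (q t) by apply: kl_integrand_ge0 => //; exact: ltW.
have H20 : 0 <= H2 by exact: integral_ge0.
have h12 x t : 0 <= kl_integrand (P ord0 x * p t) (Q ord0 x * q t).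
  by apply: kl_integrand_ge0; rewrite ?mulr_gt0// ltW// mulr_gt0.
have inner x : \int[mpow mu n]_t kl_integrand (P ord0 x * p t) (Q ord0 x * q t) =
    kl_integrand (P ord0 x) (Q ord0 x) + (P ord0 x)%:E * H2.
  set a := P ord0 x; set b := Q ord0 x.
  have a0 : (0 < a)%R by exact: P0.
  have b0 : (0 < b)%R by exact: Q0.
  (* The logarithm splits; the correction terms that do not match are put on both sides. As [p] and
     [q] have mass 1, each extra sum integrates to the finite number [a + b], which cancels. *)
  have key t : kl_integrand (a * p t) (b * q t) + (a%:E * (q t)%:E + b%:E * (p t)%:E) =
      kl_integrand a b * (p t)%:E + a%:E * kl_integrand (p t) (q t) +
      (b%:E * (q t)%:E + a%:E * (p t)%:E).
    rewrite /kl_integrand !gt_eqF ?mulr_gt0// -!EFinM -!EFinD; congr EFin.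
    by rewrite !lnM ?posrE//; ring.
  have mpE : measurable_fun setT (fun t => (p t)%:E) by exact/measurable_EFinP.
  have mqE : measurable_fun setT (fun t => (q t)%:E) by exact/measurable_EFinP.
  have pE0 t : 0 <= (p t)%:E by rewrite lee_fin ltW.
  have qE0 t : 0 <= (q t)%:E by rewrite lee_fin ltW.
  have aE : 0 <= a%:E by rewrite lee_fin ltW.
  have bE : 0 <= b%:E by rewrite lee_fin ltW.
  have hab := h1 x; rewrite -/a -/b in hab.
  have mab : measurable_fun setT (fun t => kl_integrand (a * p t) (b * q t)).
    by apply: measurable_kl_integrand; apply: measurable_funM.
  have mM (k : \bar R) (f : n.-tuple T -> \bar R) : measurable_fun setT f ->
      measurable_fun setT (fun t => k * f t).
    by move=> mf; apply: emeasurable_funM.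
  have mMr (k : \bar R) (f : n.-tuple T -> \bar R) : measurable_fun setT f ->
      measurable_fun setT (fun t => f t * k).
    by move=> mf; apply: emeasurable_funM.
  have : \int[mpow mu n]_t (kl_integrand (a * p t) (b * q t) +
       (a%:E * (q t)%:E + b%:E * (p t)%:E)) =
     \int[mpow mu n]_t (kl_integrand a b * (p t)%:E + a%:E * kl_integrand (p t) (q t) +
      (b%:E * (q t)%:E + a%:E * (p t)%:E)) by apply: eq_integral.
  have m3 := mM (kl_integrand a b) _ mpE; have m4 := mM a%:E _ m2.
  have m5 := mM b%:E _ mqE; have m6 := mM a%:E _ mpE.
  have m7 := mM a%:E _ mqE; have m8 := mM b%:E _ mpE.
  have m34 := emeasurable_funD m3 m4; have m56 := emeasurable_funD m5 m6.
  have m78 := emeasurable_funD m7 m8.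
  have n3 t : 0 <= kl_integrand a b * (p t)%:E by rewrite mule_ge0.
  have n4 t : 0 <= a%:E * kl_integrand (p t) (q t) by rewrite mule_ge0.
  have n5 t : 0 <= b%:E * (q t)%:E by rewrite mule_ge0.
  have n6 t : 0 <= a%:E * (p t)%:E by rewrite mule_ge0.
  have n7 t : 0 <= a%:E * (q t)%:E by rewrite mule_ge0.
  have n8 t : 0 <= b%:E * (p t)%:E by rewrite mule_ge0.
  have n34 t : 0 <= kl_integrand a b * (p t)%:E + a%:E * kl_integrand (p t) (q t) by rewrite adde_ge0.
  have n56 t : 0 <= b%:E * (q t)%:E + a%:E * (p t)%:E by rewrite adde_ge0.
  have n78 t : 0 <= a%:E * (q t)%:E + b%:E * (p t)%:E by rewrite adde_ge0.
  have n0 t : 0 <= kl_integrand (a * p t) (b * q t) by exact: h12.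
  rewrite !ge0_integralTD//.
  rewrite !ge0_integralTZl// p1 q1 !mule1 -/H2 [b%:E + a%:E]addeC.
  have abfin : (a%:E + b%:E) \is a fin_num by [].
  by move/(congr1 (fun z => z - (a%:E + b%:E))); rewrite !addeK.
transitivity (\int[mu]_x (kl_integrand (P ord0 x) (Q ord0 x) + (P ord0 x)%:E * H2)).
  apply: eq_integral => x _; rewrite -inner; apply: eq_integral => t _.
  by rewrite !prod_tuple_cons.
rewrite ge0_integralTD//.
- rewrite ge0_integralTZr ?P1 ?mul1e//.
  + by move=> x; rewrite lee_fin ltW.
  + exact/measurable_EFinP.
- by move=> x; rewrite mule_ge0// lee_fin ltW.
- by apply: emeasurable_funM => //; exact/measurable_EFinP.
Qed.

End product_integrals.

(** * Lebesgue measure on the tuple sigma-algebra *)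

Section lebesgue_default_display.
Context {R : realType}.
Local Open Scope ereal_scope.
Local Notation leb := (@lebesgue_measure R).

(* [lebesgue_measure] is a measure on [measurableTypeR R], whose display is not
   convertible to that of the canonical structure on [R] used by the tuple
   sigma-algebra; [lebR] is the same set function on the latter. *)
Lemma lebR_subproof : {nu : {sigma_finite_measure set R -> \bar R} |
  nu = lebesgue_measure :> (set R -> \bar R)}.
Proof.
have [mu muE] : {mu : set R -> \bar R | mu = @lebesgue_measure R} by exists leb.
have s0 : mu set0 = 0 by rewrite muE; exact: (@measure0 _ _ _ leb).
have sge0 A : 0 <= mu A by rewrite muE; exact: (@measure_ge0 _ _ _ leb).
have sadd : semi_sigma_additive mu.
  by rewrite muE; exact: (@measure_semi_sigma_additive _ _ _ leb).
pose M : {measure set R -> \bar R} := HB.pack mu (isMeasure.Build _ _ _ _ s0 sge0 sadd).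
have sf : sigma_finite setT M by rewrite /= muE; exact: (@sigma_finiteT _ _ _ leb).
pose S : {sigma_finite_measure set R -> \bar R} :=
  HB.pack (Measure.sort M) (Measure.class M) (Measure_isSigmaFinite.Build _ _ _ M sf).
by exists S.
Qed.

Definition lebR : {sigma_finite_measure set R -> \bar R} := sval lebR_subproof.

Lemma lebRE : lebR = lebesgue_measure :> (set R -> \bar R).
Proof. exact: (svalP lebR_subproof). Qed.

Lemma ge0_integral_lebR (f : R -> \bar R) : measurable_fun setT f ->
  (forall x, 0 <= f x) -> \int[lebR]_x f x = \int[leb]_x f x.
Proof.
move=> mf f0.
have mid : measurable_fun setT (id : measurableTypeR R -> R).
  by move=> _ Y mY; rewrite setTI preimage_id.
have := @ge0_integral_pushforward _ _ (measurableTypeR R) R R id mid leb setT f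
  measurableT mf (fun x _ => f0 x).
rewrite /pushforward (_ : (fun A => _) = lebR)// lebRE.
by apply/funext => A; rewrite preimage_id.
Qed.

Lemma lebesgue_Rn_measure n : {nu : {measure set (n.-tuple R) -> \bar R} |
  nu = lebesgue_Rn n :> (set (n.-tuple R) -> \bar R)}.
Proof.
pose M' := mpow leb n.
have [mu muE] : {mu : set (n.-tuple R) -> \bar R | mu = M'} by exists M'.
have s0 : mu set0 = 0 by rewrite muE; exact: (@measure0 _ _ _ M').
have sge0 A : 0 <= mu A by rewrite muE; exact: (@measure_ge0 _ _ _ M').
have sadd : semi_sigma_additive mu.
  by rewrite muE; exact: (@measure_semi_sigma_additive _ _ _ M').
pose M : {measure set (n.-tuple R) -> \bar R} :=
  HB.pack mu (isMeasure.Build _ _ _ _ s0 sge0 sadd).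
by exists M; rewrite /= muE /lebesgue_Rn mpowE.
Qed.

(** Both sides push forward a product measure along [tuple_cons]. The two products agree on
    rectangles by induction, hence everywhere by uniqueness of the product measure. *)
Lemma lebesgue_Rn_lebR n (A : set (n.-tuple R)) : measurable A ->
  lebesgue_Rn n A = mpow lebR n A.
Proof.
elim: n A => [|n IH] A mA; first by rewrite -mpowE.
have mc : measurable_fun setT (@tuple_cons _ R n) by exact: measurable_tuple_cons.
have mcA : measurable (@tuple_cons _ R n @^-1` A).
  by rewrite -[X in measurable X]setTI; exact: mc.
rewrite -[in RHS]mpowE /lebesgue_Rn /= !mpowE /pushforward.
pose M' := leb \x mpow leb n.
have [mu muE] : {mu : set (R * n.-tuple R) -> \bar R | mu = M'} by exists M'.
have s0 : mu set0 = 0 by rewrite muE; exact: (@measure0 _ _ _ M').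
have sge0 B : 0 <= mu B by rewrite muE; exact: (@measure_ge0 _ _ _ M').
have sadd : semi_sigma_additive mu.
  by rewrite muE; exact: (@measure_semi_sigma_additive _ _ _ M').
pose M : {measure set (R * n.-tuple R) -> \bar R} :=
  HB.pack mu (isMeasure.Build _ _ _ _ s0 sge0 sadd).
transitivity (M (@tuple_cons _ R n @^-1` A)); first by rewrite /= muE.
apply/esym/product_measure_unique => // B C mB mC.
rewrite /= muE /M'.
have -> : (leb \x mpow leb n) (B `*` C) = leb B * mpow leb n C.
  exact: product_measure1E.
by rewrite -IH// /lebesgue_Rn mpowE lebRE.
Qed.

(** The gateway from the integrals in the definitions of loss and risk to a packaged sigma-finite
    measure, for which Tonelli's theorem is available. *)
Lemma integral_lebesgue_Rn n (f : n.-tuple R -> \bar R) :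
  \int[lebesgue_Rn n]_x f x = \int[mpow lebR n]_x f x.
Proof.
have [nu nuE] := lebesgue_Rn_measure n; rewrite -nuE.
apply: eq_measure_integral => A mA _.
by rewrite -[RHS]lebesgue_Rn_lebR// -nuE.
Qed.

End lebesgue_default_display.

(** * Gaussian densities and the risk of product estimators *)

Section gaussian_density.
Context {R : realType}.
Implicit Types (w a x : R).

Definition gauss w a x : R := normal_pdf a (Num.sqrt w) x.

Lemma gaussE w a x : 0 < w ->
  gauss w a x = (Num.sqrt (w * pi *+ 2))^-1 * expR (- (x - a) ^+ 2 / (w *+ 2)).
Proof.
move=> w0; rewrite /gauss normal_pdfE ?gt_eqF ?sqrtr_gt0//.
by rewrite /normal_peak /normal_fun sqr_sqrtr// ltW.
Qed.

Lemma gauss_gt0 w a x : 0 < w -> 0 < gauss w a x.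
Proof.
move=> w0; rewrite gaussE// mulr_gt0 ?expR_gt0// invr_gt0 sqrtr_gt0.
by rewrite pmulrn_lgt0// mulr_gt0// pi_gt0.
Qed.

Lemma ln_gauss w a x : 0 < w ->
  ln (gauss w a x) = - ln (Num.sqrt (w * pi *+ 2)) - (x - a) ^+ 2 / (w *+ 2).
Proof.
move=> w0.
have s0 : 0 < Num.sqrt (w * pi *+ 2).
  by rewrite sqrtr_gt0 pmulrn_lgt0// mulr_gt0// pi_gt0.
by rewrite gaussE// lnM ?posrE ?expR_gt0 ?invr_gt0// lnV ?posrE// expRK mulNr.
Qed.

Lemma measurable_gauss w d (Z : measurableType d) (f g : Z -> R) : 0 < w ->
  measurable_fun setT f -> measurable_fun setT g ->
  measurable_fun setT (fun z => gauss w (f z) (g z)).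
Proof.
move=> w0 mf mg; under eq_fun do rewrite gaussE//.
apply: measurable_funM => //; apply: measurable_fun_expR.
apply: measurable_funM => //; apply: measurableT_comp => //.
by apply: measurable_funX; exact: measurable_funB.
Qed.

Lemma integral_gauss w a : (\int[lebR]_x (gauss w a x)%:E = 1)%E.
Proof.
rewrite ge0_integral_lebR; first exact: integral_normal_pdf.
  by apply/measurable_EFinP; exact: measurable_normal_pdf.
by move=> x; rewrite lee_fin normal_pdf_ge0.
Qed.

End gaussian_density.

Section risk_theory.
Context {R : realType}.
Variable r : R.
Hypothesis r0 : 0 < r.
Local Open Scope ereal_scope.
Local Notation leb := (@lebR R).

Local Notation Leb n := (mpow leb n).

Lemma gaussian_pdf_gt0 n w (theta y : n.-tuple R) : (0 < w)%R ->
  (0 < gaussian_pdf w theta y)%R.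
Proof. by move=> w0; apply: prodr_gt0 => i _; exact: gauss_gt0. Qed.

Lemma measurable_gaussian_pdf n w d (Z : measurableType d) (f g : Z -> n.-tuple R) :
  (0 < w)%R -> measurable_fun setT f -> measurable_fun setT g ->
  measurable_fun setT (fun z => gaussian_pdf w (f z) (g z)).
Proof.
move=> w0 mf mg; apply: measurable_fun_prod_ord => i.
by apply: measurable_gauss => //; exact: measurable_fun_tnth.
Qed.

Lemma integral_gaussian_pdf n w (theta : n.-tuple R) : (0 < w)%R ->
  \int[Leb n]_y (gaussian_pdf w theta y)%:E = 1.
Proof.
move=> w0.
apply: (integral_tprod (F := fun i => gauss w (tnth theta i))) => [i|i x|i].
- exact: measurable_gauss.
- exact/ltW/gauss_gt0.
- exact: integral_gauss.
Qed.

Lemma KL_lossE n (theta : n.-tuple R) (q : n.-tuple R -> R) :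
  measurable_fun setT q -> (forall y, 0 <= q y)%R ->
  \int[Leb n]_y (q y)%:E = 1 ->
  KL_loss r theta q = \int[Leb n]_y kl_integrand (gaussian_pdf r theta y) (q y).
Proof.
move=> mq q0 q1; rewrite /KL_loss integral_lebesgue_Rn integral_kl_integrand//.
- exact: measurable_gaussian_pdf.
- by move=> y; exact: gaussian_pdf_gt0.
- exact: integral_gaussian_pdf.
Qed.

Lemma measurable_section n (phat : n.-tuple R -> n.-tuple R -> R) x :
  measurable_fun setT (fun z : n.-tuple R * n.-tuple R => phat z.1 z.2) ->
  measurable_fun setT (phat x).
Proof.
by move=> m; exact: (measurable_fun_comp2 m).
Qed.

Lemma riskE n (theta : n.-tuple R) phat : predictive_density phat ->
  risk r theta phat = \int[Leb n]_x
    ((\int[Leb n]_y kl_integrand (gaussian_pdf r theta y) (phat x y)) *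
      (gaussian_pdf 1 theta x)%:E).
Proof.
case=> p0 mp p1; rewrite /risk integral_lebesgue_Rn; apply: eq_integral => x _.
rewrite KL_lossE//; first exact: measurable_section.
by rewrite -integral_lebesgue_Rn.
Qed.

(** The one-coordinate risk, on scalars instead of 1-tuples and with the nonnegative integrand in
    place of the logarithmic one. *)
Definition risk1 (a : R) (q : R -> R -> R) :=
  \int[leb]_x ((\int[leb]_y kl_integrand (gauss r a y) (q x y)) * (gauss 1 a x)%:E).

Definition product_pd n (q : R -> R -> R) (x y : n.-tuple R) : R :=
  (\prod_(i < n) q (tnth x i) (tnth y i))%R.

Variable q : R -> R -> R.
Hypothesis mq : measurable_fun setT (fun z : R * R => q z.1 z.2).
Hypothesis q0 : forall x y, (0 < q x y)%R.
Hypothesis q1 : forall x, \int[leb]_y (q x y)%:E = 1.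

Let mqx x : measurable_fun setT (q x).
Proof.
exact: (measurable_fun_comp2 mq).
Qed.

Lemma product_pdP n : predictive_density (@product_pd n q).
Proof.
split.
- by move=> x y; apply: prodr_ge0 => i _; exact: ltW.
- apply: measurable_fun_prod_ord => i.
  by apply: (measurable_fun_comp2 mq); exact: measurable_fun_tnth.
- move=> x; rewrite integral_lebesgue_Rn.
  by apply: (integral_tprod (F := fun i => q (tnth x i))) => // i y; exact: ltW.
Qed.

Lemma measurable_kl d (Z : measurableType d) (f g : Z -> R) :
  measurable_fun setT f -> measurable_fun setT g ->
  measurable_fun setT (fun z => \int[leb]_y kl_integrand (gauss r (f z) y) (q (g z) y)).
Proof.
move=> mf mg; apply: measurable_integral2.
  apply: measurable_kl_integrand.
    by apply: measurable_gauss => //; exact: measurableT_comp.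
  by apply: (measurable_fun_comp2 mq) => //; exact: measurableT_comp.
by move=> x y; apply: kl_integrand_ge0; [exact: gauss_gt0|exact: ltW].
Qed.

Lemma kl_ge0 a x : 0 <= \int[leb]_y kl_integrand (gauss r a y) (q x y).
Proof.
by apply: integral_ge0 => y _; apply: kl_integrand_ge0; [exact: gauss_gt0|exact: ltW].
Qed.

Lemma risk1_ge0 a : 0 <= risk1 a q.
Proof.
apply: integral_ge0 => x _; rewrite mule_ge0 ?kl_ge0// lee_fin ltW//.
exact: gauss_gt0.
Qed.

(** For fixed [x] the loss is a sum over coordinates by additivity of relative entropy; the [i]-th
    summand depends on [x] only through its [i]-th entry, and the other entries integrate out. *)
Lemma risk_product n (theta : n.-tuple R) :
  risk r theta (product_pd q) = \sum_(i < n) risk1 (tnth theta i) q.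
Proof.
rewrite riskE; last exact: product_pdP.
have P0 i x : (0 <= gauss 1 (tnth theta i) x)%R by exact/ltW/gauss_gt0.
have mP i : measurable_fun setT (gauss 1 (tnth theta i)) by exact: measurable_gauss.
have P1 (i : 'I_n) : \int[leb]_x (gauss 1 (tnth theta i) x)%:E = 1 by exact: integral_gauss.
have mPr i : measurable_fun setT (gauss r (tnth theta i)) by exact: measurable_gauss.
have mk i : measurable_fun setT
    (fun x => \int[leb]_y kl_integrand (gauss r (tnth theta i) y) (q x y)).
  exact: measurable_kl.
transitivity (\int[Leb n]_x \sum_(i < n)
    ((\int[leb]_y kl_integrand (gauss r (tnth theta i) y) (q (tnth x i) y)) *
      (gaussian_pdf 1 theta x)%:E)).
  apply: eq_integral => x _; rewrite -ge0_sume_distrl; last first.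
    by move=> i _; exact: kl_ge0.
  congr (_ * _).
  exact: (integral_kl_integrand_tprod (P := fun i => gauss r (tnth theta i))
    (Q := fun i => q (tnth x i)) mPr
    (fun=> mqx _) (fun i y => gauss_gt0 _ _ r0) (fun=> q0 _) (fun=> integral_gauss _ _)
    (fun=> q1 _)).
rewrite ge0_integral_sum//.
- apply: eq_bigr => i _; rewrite /risk1.
  exact: (integral_tprod_marginal (F := fun i => gauss 1 (tnth theta i))
    (f := fun x => \int[leb]_y kl_integrand (gauss r (tnth theta i) y) (q x y))
    i mP P0 P1 (mk i) (kl_ge0 (tnth theta i))).
- move=> i; apply: emeasurable_funM.
    by apply: measurable_kl => //; exact: measurable_fun_tnth.
  by apply/measurable_EFinP; exact: measurable_gaussian_pdf.
- by move=> i x _; rewrite mule_ge0 ?kl_ge0// lee_fin ltW// gaussian_pdf_gt0.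
Qed.

End risk_theory.

(** * Bayes predictive densities *)

(** This is [ln t <= t] at [t = u / q], multiplied by [p]. Giving up the [- 1] of [ln t <= t - 1]
    keeps all terms nonnegative; it is the source of the additive 1 in [bayes_lower_bound]. *)
Lemma kl_integrand_gibbs (R : realType) (p q u : R) : 0 < p -> 0 < q -> 0 <= u ->
  (kl_integrand p q + u%:E <= kl_integrand p u + (p * u / q)%:E + q%:E)%E.
Proof.
move=> p0 q0 u0; rewrite /kl_integrand (gt_eqF q0); case: eqP => [_|/eqP un0].
  by rewrite leey.
have u1 : 0 < u by rewrite lt0r un0.
have := @ln_ub_sub1 _ (u / q) (divr_gt0 u1 q0); rewrite ln_div ?posrE// => H.
rewrite -!EFinD lee_fin.
have : p * (ln u - ln q) <= p * (u / q) by rewrite ler_pM2l//; lra.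
by rewrite mulrA; lra.
Qed.

Lemma ge0_integral_atom d (T : measurableType d) (R : realType)
    (mu : {measure set T -> \bar R}) (f : T -> \bar R) a :
  measurable [set a] -> measurable_fun setT f -> (forall x, 0 <= f x)%E ->
  (f a * mu [set a] <= \int[mu]_x f x)%E.
Proof.
move=> ma mf f0.
apply: (@le_trans _ _ (\int[mu]_(x in [set a]) f x)%E); last first.
  by apply: ge0_subset_integral.
rewrite (eq_integral (cst (f a))) ?integral_cst// => x.
by rewrite inE => ->.
Qed.

Section bayes.
Context {R : realType}.
Variable r : R.
Hypothesis r0 : 0 < r.
Variable pi0 : {sigma_finite_measure set R -> \bar R}.
Hypothesis pi0T : pi0 setT = 1%E.
Hypothesis pi00 : (0 < pi0 [set 0%R])%E.
Local Notation leb := (@lebR R).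
Local Open Scope ereal_scope.

Let bm1 x := \int[pi0]_t (gauss 1 t x)%:E.
Let bm2 x y := \int[pi0]_t (gauss 1 t x * gauss r t y)%:E.

Lemma integral_bounded_fin (f : R -> R) (C : R) : measurable_fun setT f ->
  (forall t, 0 <= f t <= C)%R -> \int[pi0]_t (f t)%:E \is a fin_num.
Proof.
move=> mf fC; rewrite ge0_fin_numE; last first.
  by apply: integral_ge0 => t _; rewrite lee_fin; case/andP: (fC t).
apply: (@le_lt_trans _ _ C%:E); last exact: ltry.
have -> : C%:E = \int[pi0]_t (cst C%:E) t by rewrite integral_cst//= pi0T mule1.
apply: ge0_le_integralT => //.
- by move=> t; rewrite lee_fin; case/andP: (fC t).
- exact/measurable_EFinP.
- by move=> t; rewrite lee_fin; case/andP: (fC t).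
Qed.

(** The atom at 0 alone makes the integral positive; this is what allows division by the marginal
    densities. *)
Lemma integral_pos (f : R -> R) : measurable_fun setT f ->
  (forall t, 0 < f t)%R -> 0 < \int[pi0]_t (f t)%:E.
Proof.
move=> mf f0; apply: (@lt_le_trans _ _ ((f 0%R)%:E * pi0 [set 0%R])).
  by rewrite mule_gt0// lte_fin.
apply: (@ge0_integral_atom _ _ _ pi0 (fun t => (f t)%:E) 0%R) => //.
- exact/measurable_EFinP.
- by move=> t; rewrite lee_fin ltW.
Qed.

Let gauss_bnd (w t x : R) : (0 < w)%R -> (0 <= gauss w t x <= @normal_peak R (Num.sqrt w))%R.
Proof.
move=> w0; rewrite ltW ?gauss_gt0//=; apply: normal_pdf_ub.
by rewrite gt_eqF// sqrtr_gt0.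
Qed.

Let m1t x : measurable_fun setT (fun t : R => gauss 1 t x).
Proof. exact: measurable_gauss. Qed.

Let m2t x y : measurable_fun setT (fun t : R => gauss 1 t x * gauss r t y)%R.
Proof. by apply: measurable_funM; exact: measurable_gauss. Qed.

Let bm1_fin x : bm1 x \is a fin_num.
Proof. by apply: integral_bounded_fin => // t; exact: gauss_bnd. Qed.

Let bm2_fin x y : bm2 x y \is a fin_num.
Proof.
apply: (@integral_bounded_fin _ (@normal_peak R (Num.sqrt 1) * @normal_peak R (Num.sqrt r))) => //.
move=> t; have /andP[a1 a2] := @gauss_bnd 1%R t x ltr01.
have /andP[b1 b2] := @gauss_bnd r t y r0.
by rewrite mulr_ge0//= ler_pM.
Qed.

(** Marginal density of [x], and below of the pair [(x, y)], when the mean has law [pi0]. They are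
    finite because a Gaussian density is bounded by its peak. *)
Definition marg1 x : R := fine (bm1 x).
Definition marg2 x y : R := fine (bm2 x y).

Lemma marg1E x : (marg1 x)%:E = \int[pi0]_t (gauss 1 t x)%:E.
Proof. by rewrite fineK. Qed.

Lemma marg2E x y : (marg2 x y)%:E = \int[pi0]_t (gauss 1 t x * gauss r t y)%:E.
Proof. by rewrite fineK. Qed.

Lemma marg1_gt0 x : (0 < marg1 x)%R.
Proof. by rewrite -lte_fin marg1E integral_pos// => t; exact: gauss_gt0. Qed.

Lemma marg2_gt0 x y : (0 < marg2 x y)%R.
Proof.
by rewrite -lte_fin marg2E integral_pos// => t; rewrite mulr_gt0// gauss_gt0.
Qed.

Lemma measurable_marg1 : measurable_fun setT marg1.
Proof.
apply/measurable_EFinP.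
apply: (eq_measurable_fun bm1); first by move=> x _; rewrite /= marg1E.
apply: measurable_integral2.
  by apply/measurable_EFinP; exact: measurable_gauss.
by move=> x t; rewrite lee_fin ltW// gauss_gt0.
Qed.

Lemma measurable_marg2 : measurable_fun setT (fun z : R * R => marg2 z.1 z.2).
Proof.
apply/measurable_EFinP.
apply: (eq_measurable_fun (fun z : R * R => bm2 z.1 z.2)).
  by move=> x _; rewrite /= marg2E.
apply: (@measurable_integral2 _ _ _ _ _ pi0
  (fun (z : R * R) t => (gauss 1 t z.1 * gauss r t z.2)%:E)).
  apply/measurable_EFinP; apply: measurable_funM; apply: measurable_gauss => //;
  exact: measurableT_comp.
by move=> x t; rewrite lee_fin ltW// mulr_gt0// gauss_gt0.
Qed.

Lemma integral_marg2 x : \int[leb]_y (marg2 x y)%:E = (marg1 x)%:E.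
Proof.
under eq_integral do rewrite marg2E.
rewrite marg1E.
rewrite (fubini_tonelli (m1 := leb) (m2 := pi0)
  (fun z : R * R => (gauss 1 z.2 x * gauss r z.2 z.1)%:E)); first last.
- by move=> z; rewrite lee_fin ltW// mulr_gt0// gauss_gt0.
- by apply/measurable_EFinP; apply: measurable_funM; exact: measurable_gauss.
apply: eq_integral => t _ /=.
under eq_integral do rewrite EFinM.
rewrite ge0_integralTZl ?integral_gauss ?mule1//.
- by move=> y; rewrite lee_fin ltW// gauss_gt0.
- by rewrite lee_fin ltW// gauss_gt0.
- by apply/measurable_EFinP; exact: measurable_gauss.
Qed.

Lemma integral_marg1 : \int[leb]_x (marg1 x)%:E = 1.
Proof.
under eq_integral do rewrite marg1E.
rewrite (fubini_tonelli (m1 := leb) (m2 := pi0)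
  (fun z : R * R => (gauss 1 z.2 z.1)%:E)); first last.
- by move=> z; rewrite lee_fin ltW// gauss_gt0.
- by apply/measurable_EFinP; exact: measurable_gauss.
under eq_integral do rewrite integral_gauss.
by rewrite integral_cst//= pi0T mule1.
Qed.

Definition bayes_pd x y : R := (marg2 x y / marg1 x)%R.

Lemma bayes_pd_gt0 x y : (0 < bayes_pd x y)%R.
Proof. by rewrite divr_gt0// (marg1_gt0, marg2_gt0). Qed.

Lemma measurable_bayes_pd : measurable_fun setT (fun z : R * R => bayes_pd z.1 z.2).
Proof.
apply: measurable_funM; first exact: measurable_marg2.
apply: measurable_fun_inv; first by move=> z; exact: marg1_gt0.
by apply: measurableT_comp => //; exact: measurable_marg1.
Qed.

Lemma integral_bayes_pd x : \int[leb]_y (bayes_pd x y)%:E = 1.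
Proof.
under eq_integral do rewrite /bayes_pd mulrC EFinM.
have m1 := marg1_gt0 x.
rewrite ge0_integralTZl ?integral_marg2.
- by rewrite -EFinM mulVf ?gt_eqF.
- by move=> y; rewrite lee_fin ltW// marg2_gt0.
- by rewrite lee_fin invr_ge0 ltW.
- by apply/measurable_EFinP; exact: (measurable_fun_comp2 measurable_marg2).
Qed.

(** * Near-optimality of the product Bayes density on every measurable set *)

Section gibbs_lower_bound.
Variables (n : nat) (phat : n.-tuple R -> n.-tuple R -> R).
Hypothesis phatP : predictive_density phat.
Let Q := @product_pd R n bayes_pd.
Let G1 (t x : n.-tuple R) := gaussian_pdf 1 t x.
Let Gr (t y : n.-tuple R) := gaussian_pdf r t y.
Local Notation L := (mpow leb n).
Local Notation Pi := (mpow pi0 n).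

Let p0 x y : (0 <= phat x y)%R. Proof. by case: phatP => + _ _; exact. Qed.
Let mp : measurable_fun setT (fun z : n.-tuple R * n.-tuple R => phat z.1 z.2).
Proof. by case: phatP. Qed.
Let p1 x : \int[L]_y (phat x y)%:E = 1.
Proof. by case: phatP => _ _; rewrite -integral_lebesgue_Rn. Qed.
Let QP : predictive_density Q.
Proof.
apply: product_pdP.
- exact: measurable_bayes_pd.
- exact: bayes_pd_gt0.
- exact: integral_bayes_pd.
Qed.
Let mQ : measurable_fun setT (fun z : n.-tuple R * n.-tuple R => Q z.1 z.2).
Proof. by case: QP. Qed.
Let Q1 x : \int[L]_y (Q x y)%:E = 1.
Proof. by case: QP => _ _; rewrite -integral_lebesgue_Rn. Qed.
Let Q0 x y : (0 < Q x y)%R.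
Proof. by apply: prodr_gt0 => i _; exact: bayes_pd_gt0. Qed.
Let G10 t x : (0 < G1 t x)%R. Proof. exact: gaussian_pdf_gt0. Qed.
Let Gr0 t x : (0 < Gr t x)%R. Proof. exact: gaussian_pdf_gt0. Qed.

Let ratio t x y := (Gr t y * phat x y / Q x y)%R.

Let ratio_ge0 t x y : 0 <= (ratio t x y)%:E.
Proof. by rewrite lee_fin mulr_ge0 ?invr_ge0 ?(ltW (Q0 _ _))// mulr_ge0// ltW. Qed.

Let m_ratio d (Z : measurableType d) (f g h : Z -> n.-tuple R) :
  measurable_fun setT f -> measurable_fun setT g -> measurable_fun setT h ->
  measurable_fun setT (fun z => (ratio (f z) (g z) (h z))%:E).
Proof.
move=> mf mg mh; apply/measurable_EFinP; apply: measurable_funM.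
  apply: measurable_funM; first exact: measurable_gaussian_pdf.
  exact: (measurable_fun_comp2 mp).
apply: measurable_fun_inv; first by move=> z; exact: Q0.
exact: (measurable_fun_comp2 mQ).
Qed.

Let kl_le t x : \int[L]_y kl_integrand (Gr t y) (Q x y) <=
  \int[L]_y kl_integrand (Gr t y) (phat x y) + \int[L]_y (ratio t x y)%:E.
Proof.
have mG : measurable_fun setT (Gr t) by exact: measurable_gaussian_pdf.
have mQx : measurable_fun setT (Q x) by exact: (measurable_fun_comp2 mQ).
have mpx : measurable_fun setT (phat x) by exact: (measurable_fun_comp2 mp).
have mr : measurable_fun setT (fun y => (ratio t x y)%:E) by exact: m_ratio.
have mQE : measurable_fun setT (fun y => (Q x y)%:E) by exact/measurable_EFinP.
have mpE : measurable_fun setT (fun y => (phat x y)%:E) by exact/measurable_EFinP.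
have m1 : measurable_fun setT (fun y => kl_integrand (Gr t y) (Q x y)) by exact: measurable_kl_integrand.
have m2 : measurable_fun setT (fun y => kl_integrand (Gr t y) (phat x y)) by exact: measurable_kl_integrand.
have n1 y : 0 <= kl_integrand (Gr t y) (Q x y) by apply: kl_integrand_ge0 => //; exact: ltW.
have n2 y : 0 <= kl_integrand (Gr t y) (phat x y) by exact: kl_integrand_ge0.
have nQ y : 0 <= (Q x y)%:E by rewrite lee_fin ltW.
have np y : 0 <= (phat x y)%:E by rewrite lee_fin.
have m3 := emeasurable_funD m1 mpE.
have m4 := emeasurable_funD m2 mr.
have m5 := emeasurable_funD m4 mQE.
have n3 y : 0 <= kl_integrand (Gr t y) (Q x y) + (phat x y)%:E by rewrite adde_ge0.
have n4 y : 0 <= kl_integrand (Gr t y) (phat x y) + (ratio t x y)%:E by rewrite adde_ge0.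
(* The 1 added to both sides is the mass of [phat x] on the left and of [Q x] on the right, as the
   pointwise inequality requires. *)
rewrite -(@leeD2rE _ 1)// -[in leLHS](p1 x) -[in leRHS](Q1 x).
rewrite -!ge0_integralTD//.
by apply: ge0_le_integralT => // y; exact: kl_integrand_gibbs.
Qed.

Let W t x y := (ratio t x y)%:E * (G1 t x)%:E.

Let mW : measurable_fun setT
  (fun z : (n.-tuple R * n.-tuple R) * n.-tuple R => W z.1.1 z.1.2 z.2).
Proof.
apply: emeasurable_funM.
  by apply: m_ratio => //; exact: measurableT_comp.
apply/measurable_EFinP; apply: measurable_gaussian_pdf => //;
exact: measurableT_comp.
Qed.

Let W0 t x y : 0 <= W t x y.
Proof. by rewrite mule_ge0// lee_fin ltW. Qed.

Let mWint : measurable_fun setT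
  (fun z : n.-tuple R * n.-tuple R => \int[L]_y W z.1 z.2 y).
Proof.
exact: (@measurable_integral2 _ _ _ _ _ L
  (fun z : n.-tuple R * n.-tuple R => W z.1 z.2) mW).
Qed.

(* Integrating the prior out turns numerator and denominator of [ratio] into the
   same product of marginals. *)
Let mixture_one x y : \int[Pi]_t W t x y = (phat x y * \prod_(i < n) marg1 (tnth x i))%:E.
Proof.
pose F (i : 'I_n) t := (gauss 1 t (tnth x i) * gauss r t (tnth y i) /
  marg2 (tnth x i) (tnth y i))%R.
have Fge i t : (0 <= F i t)%R.
  by rewrite divr_ge0 ?mulr_ge0 ?ltW ?gauss_gt0 ?marg2_gt0.
have mF i : measurable_fun setT (F i) by apply: measurable_funM.
have F1 i : \int[pi0]_t (F i t)%:E = 1.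
  under eq_integral do rewrite EFinM.
  rewrite ge0_integralTZr.
  - by rewrite -marg2E -EFinM divff// gt_eqF// marg2_gt0.
  - by move=> t; rewrite lee_fin mulr_ge0// ltW// gauss_gt0.
  - by rewrite lee_fin invr_ge0 ltW// marg2_gt0.
  - exact/measurable_EFinP.
have WE t : W t x y = (phat x y * \prod_(i < n) marg1 (tnth x i))%:E *
    (\prod_(i < n) F i (tnth t i))%:E.
  rewrite /W /ratio /Q /product_pd /G1 /Gr /gaussian_pdf -!EFinM; congr EFin.
  rewrite /bayes_pd /F !(big_split, prodfV)/=.
  have a0 : (\prod_(i < n) marg1 (tnth x i) != 0)%R.
    by rewrite gt_eqF// prodr_gt0// => i _; exact: marg1_gt0.
  have b0 : (\prod_(i < n) marg2 (tnth x i) (tnth y i) != 0)%R.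
    by rewrite gt_eqF// prodr_gt0// => i _; exact: marg2_gt0.
  by field; rewrite a0 b0.
under eq_integral do rewrite WE.
rewrite ge0_integralTZl ?(integral_tprod mF Fge F1) ?mule1//.
- by move=> t; rewrite lee_fin prodr_ge0.
- by rewrite lee_fin mulr_ge0// prodr_ge0// => i _; exact/ltW/marg1_gt0.
- by apply/measurable_EFinP; exact: measurable_tprod.
Qed.

(** With the prior integrated out first, what remains is [phat x y] times the marginal density of
    [x], a probability density in [(x, y)]. *)
Let integral_W : \int[Pi]_t \int[L]_x \int[L]_y W t x y = 1.
Proof.
rewrite (fubini_tonelli (m1 := Pi) (m2 := L)
  (fun z : n.-tuple R * n.-tuple R => \int[L]_y W z.1 z.2 y)); first last.
- by move=> z; exact: integral_ge0.
- exact: mWint.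
rewrite /=.
transitivity (\int[L]_x (\prod_(i < n) marg1 (tnth x i))%:E); last first.
  apply: (integral_tprod (F := fun _ => marg1)) => // i.
  - exact: measurable_marg1.
  - by move=> x; exact/ltW/marg1_gt0.
  - exact: integral_marg1.
apply: eq_integral => x _.
rewrite (fubini_tonelli (m1 := Pi) (m2 := L)
  (fun z : n.-tuple R * n.-tuple R => W z.1 x z.2)); first last.
- by move=> z; exact: W0.
- apply: (measurable_fun_comp2 (F := fun (a : n.-tuple R * n.-tuple R) b => W a.1 a.2 b)
    (f := fun z : n.-tuple R * n.-tuple R => (z.1, x)) (g := snd) mW) => //.
  exact: measurable_fun_pair.
under eq_integral do rewrite mixture_one EFinM.
rewrite ge0_integralTZr ?p1 ?mul1e//.
- by move=> y; rewrite lee_fin.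
- by rewrite lee_fin prodr_ge0// => i _; exact/ltW/marg1_gt0.
- by apply/measurable_EFinP; exact: (measurable_fun_comp2 mp).
Qed.

Lemma measurable_risk (p : n.-tuple R -> n.-tuple R -> R) :
  predictive_density p -> measurable_fun setT (fun t => risk r t p).
Proof.
move=> pP; under eq_fun do rewrite riskE//.
case: pP => pp mpp _.
apply: measurable_integral2 => [|t x]; last first.
  apply: mule_ge0; last by rewrite lee_fin ltW.
  by apply: integral_ge0 => y _; exact: kl_integrand_ge0.
apply: emeasurable_funM; last by apply/measurable_EFinP; exact: measurable_gaussian_pdf.
apply: measurable_integral2 => [|z y]; last exact: kl_integrand_ge0.
apply: measurable_kl_integrand.
  by apply: measurable_gaussian_pdf => //; exact: measurableT_comp.
by apply: (measurable_fun_comp2 mpp) => //; exact: measurableT_comp.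
Qed.

Lemma risk_ge0 (p : n.-tuple R -> n.-tuple R -> R) t :
  predictive_density p -> 0 <= risk r t p.
Proof.
move=> pP; rewrite riskE//; case: pP => pp _ _; apply: integral_ge0 => x _.
apply: mule_ge0; last by rewrite lee_fin ltW.
by apply: integral_ge0 => y _; exact: kl_integrand_ge0.
Qed.

(** For each mean, the risk of [Q] exceeds that of [phat] by at most the integral of [W]. This
    excess is nonnegative, so over [S] it contributes at most its total prior integral, which is
    1. *)
Lemma bayes_lower_bound (S : set (n.-tuple R)) : measurable S ->
  \int[Pi]_(t in S) risk r t Q <= \int[Pi]_(t in S) risk r t phat + 1.
Proof.
move=> mS.
have mI : measurable_fun setT (fun t => \int[L]_x \int[L]_y W t x y).
  apply: measurable_integral2 => [|t x]; last exact: integral_ge0.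
  exact: mWint.
have I0 t : 0 <= \int[L]_x \int[L]_y W t x y.
  by apply: integral_ge0 => x _; exact: integral_ge0.
apply: (@le_trans _ _ (\int[Pi]_(t in S) (risk r t phat + \int[L]_x \int[L]_y W t x y))).
  apply: ge0_le_integral => //.
  - by move=> t _; exact: risk_ge0.
  - by apply: measurable_funTS; exact: measurable_risk.
  - by apply: measurable_funTS; apply: emeasurable_funD => //; exact: measurable_risk.
  move=> t _; rewrite !riskE//.
  have mk (p : n.-tuple R -> n.-tuple R -> R) : predictive_density p ->
      measurable_fun setT (fun x => (\int[L]_y kl_integrand (Gr t y) (p x y)) * (G1 t x)%:E).
    case=> pp mpp _; apply: emeasurable_funM; last first.
      by apply/measurable_EFinP; exact: measurable_gaussian_pdf.
    apply: measurable_integral2 => [|z y]; last exact: kl_integrand_ge0.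
    apply: measurable_kl_integrand.
      by apply: measurable_gaussian_pdf => //; exact: measurableT_comp.
    by apply: (measurable_fun_comp2 mpp) => //; exact: measurableT_comp.
  have nk (p : n.-tuple R -> n.-tuple R -> R) x : predictive_density p ->
      0 <= (\int[L]_y kl_integrand (Gr t y) (p x y)) * (G1 t x)%:E.
    case=> pp _ _; apply: mule_ge0; last by rewrite lee_fin ltW.
    by apply: integral_ge0 => y _; exact: kl_integrand_ge0.
  have mw : measurable_fun setT (fun x => \int[L]_y W t x y).
    exact: (@measurable_fun_comp2 _ _ _ _ _ _ _ _ (fun t x => \int[L]_y W t x y)
      (cst t) id mWint).
  rewrite -ge0_integralTD//; [|by move=> x; exact: nk|by move=> x; exact: integral_ge0|exact: mk].
  apply: ge0_le_integralT => //.
  - by move=> x; exact: nk.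
  - exact: mk.
  - by apply: emeasurable_funD => //; exact: mk.
  move=> x.
  have -> : \int[L]_y W t x y = (\int[L]_y (ratio t x y)%:E) * (G1 t x)%:E.
    rewrite ge0_integralTZr//; first by rewrite lee_fin ltW.
    exact: m_ratio.
  rewrite -ge0_muleDl; first by rewrite lee_wpmul2r// lee_fin ltW.
    by apply: integral_ge0 => y _; exact: kl_integrand_ge0.
  exact: integral_ge0.
rewrite ge0_integralD//; first last.
- exact: measurable_funTS.
- by apply: measurable_funTS; exact: measurable_risk.
- by move=> t _; exact: risk_ge0.
rewrite leeD2l// -integral_W; apply: ge0_subset_integral => //.
Qed.

End gibbs_lower_bound.

End bayes.

(** * The hybrid estimator *)

Section gaussian_moments.
Context {R : realType}.
Local Notation leb := (@lebR R).
Implicit Types w a x : R.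

(* With [u = (x - a)^2 / (4 w)], from [u <= exp u]. *)
Lemma sqr_gauss_le w a x : 0 < w ->
  (x - a) ^+ 2 * gauss w a x <= 8 * w * gauss (2 * w) a x.
Proof.
move=> w0; have w20 : 0 < 2 * w by rewrite mulr_gt0.
rewrite !gaussE//.
set u := (x - a) ^+ 2 / (4 * w).
have -> : - (x - a) ^+ 2 / (w *+ 2) = - u - u by rewrite /u; field; rewrite gt_eqF.
have -> : - (x - a) ^+ 2 / (2 * w *+ 2) = - u by rewrite /u; field; rewrite gt_eqF.
have -> : (x - a) ^+ 2 = 4 * w * u by rewrite /u; field; rewrite gt_eqF.
have wpi : 0 < w * pi *+ 2 by rewrite pmulrn_lgt0// mulr_gt0// pi_gt0.
have s0 : 0 < Num.sqrt (w * pi *+ 2) by rewrite sqrtr_gt0.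
have s1 : 0 < Num.sqrt (2 * w * pi *+ 2).
  by rewrite sqrtr_gt0 pmulrn_lgt0// !mulr_gt0// pi_gt0.
have s2 : Num.sqrt (2 * w * pi *+ 2) <= 2 * Num.sqrt (w * pi *+ 2).
  have -> : 2 * Num.sqrt (w * pi *+ 2) = Num.sqrt (2 ^+ 2 * (w * pi *+ 2)).
    by rewrite sqrtrM ?sqr_ge0// sqrtr_sqr ger0_norm.
  by rewrite ler_wsqrtr//; lra.
have s3 : (Num.sqrt (w * pi *+ 2))^-1 <= 2 * (Num.sqrt (2 * w * pi *+ 2))^-1.
  rewrite -[leLHS]mul1r ler_pdivrMr// mulrAC ler_pdivlMr// mul1r.
  exact: s2.
rewrite expRD.
have eu : u * expR (- u) <= 1.
  rewrite expRN ler_pdivrMr ?expR_gt0// mul1r.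
  by apply: le_trans (expR_ge1Dx u); lra.
have e0 := expR_gt0 (- u).
have i0 : 0 < (Num.sqrt (2 * w * pi *+ 2))^-1 by rewrite invr_gt0.
have -> : 4 * w * u * ((Num.sqrt (w * pi *+ 2))^-1 * (expR (- u) * expR (- u))) =
  (4 * w * expR (- u)) * ((Num.sqrt (w * pi *+ 2))^-1 * (u * expR (- u))) by ring.
have -> : 8 * w * ((Num.sqrt (2 * w * pi *+ 2))^-1 * expR (- u)) =
  (4 * w * expR (- u)) * (2 * (Num.sqrt (2 * w * pi *+ 2))^-1) by ring.
rewrite ler_pM2l ?mulr_gt0//; apply: (le_trans _ s3).
by rewrite ler_piMr// invr_ge0 ltW.
Qed.

(** The exact value is [w]; a multiple of it suffices, since second moments enter only constants
    independent of [L]. *)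
Lemma integral_sqr_gauss w a : 0 < w ->
  (\int[leb]_x ((x - a) ^+ 2 * gauss w a x)%:E <= (8 * w)%:E)%E.
Proof.
move=> w0; have w20 : 0 < 2 * w by rewrite mulr_gt0.
have -> : ((8 * w)%:E = \int[leb]_x ((8 * w)%:E * (gauss (2 * w) a x)%:E))%E.
  rewrite ge0_integralTZl ?integral_gauss ?mule1//.
  - by move=> x; rewrite lee_fin ltW// gauss_gt0.
  - by rewrite lee_fin mulr_ge0// ltW.
  - by apply/measurable_EFinP; exact: measurable_gauss.
apply: ge0_le_integralT => [x|||x].
- by rewrite lee_fin mulr_ge0 ?sqr_ge0// ltW// gauss_gt0.
- apply/measurable_EFinP; apply: measurable_funM; last exact: measurable_gauss.
  by apply: measurable_funX; exact: measurable_funB.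
- by apply: emeasurable_funM => //; apply/measurable_EFinP; exact: measurable_gauss.
- by rewrite -EFinM lee_fin sqr_gauss_le.
Qed.

(** A quadratic bound on the log-density ratio is averaged under N(a, r). The mass 1 of the Gaussian
    on the left and of [u] on the right absorb the correction terms of [kl_integrand]. *)
Lemma kl_upper (r a b C : R) (u : R -> R) : 0 < r -> 0 <= b -> 0 <= C ->
  measurable_fun setT u -> (forall y, 0 < u y) ->
  (\int[leb]_y (u y)%:E = 1)%E ->
  (forall y, ln (gauss r a y) - ln (u y) <= b + C * (y - a) ^+ 2) ->
  (\int[leb]_y kl_integrand (gauss r a y) (u y) <= (b + C * (8 * r))%:E)%E.
Proof.
move=> r0 b0 C0 mu u0 u1 ub.
have g0 y := gauss_gt0 a y r0.
have mg : measurable_fun setT (gauss r a) by exact: measurable_gauss.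
have mgE : measurable_fun setT (fun y => (gauss r a y)%:E) by exact/measurable_EFinP.
have muE : measurable_fun setT (fun y => (u y)%:E) by exact/measurable_EFinP.
have mh : measurable_fun setT (fun y => kl_integrand (gauss r a y) (u y)) by exact: measurable_kl_integrand.
have msq : measurable_fun setT (fun y : R => ((y - a) ^+ 2 * gauss r a y)%:E).
  apply/measurable_EFinP; apply: measurable_funM => //.
  by apply: measurable_funX; exact: measurable_funB.
have gE0 y : (0 <= (gauss r a y)%:E)%E by rewrite lee_fin ltW.
have uE0 y : (0 <= (u y)%:E)%E by rewrite lee_fin ltW.
have h0 y : (0 <= kl_integrand (gauss r a y) (u y))%E by apply: kl_integrand_ge0 => //; exact: ltW.
have sq0 y : (0 <= ((y - a) ^+ 2 * gauss r a y)%:E)%E.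
  by rewrite lee_fin mulr_ge0 ?sqr_ge0// ltW.
have bE : (0 <= b%:E)%E by rewrite lee_fin.
have CE : (0 <= C%:E)%E by rewrite lee_fin.
have n1 y : (0 <= b%:E * (gauss r a y)%:E)%E by rewrite mule_ge0.
have n2 y : (0 <= C%:E * ((y - a) ^+ 2 * gauss r a y)%:E)%E by rewrite mule_ge0.
have m1 : measurable_fun setT (fun y => b%:E * (gauss r a y)%:E)%E by exact: emeasurable_funM.
have m2 : measurable_fun setT (fun y : R => C%:E * ((y - a) ^+ 2 * gauss r a y)%:E)%E.
  exact: emeasurable_funM.
have n12 y : (0 <= b%:E * (gauss r a y)%:E + C%:E * ((y - a) ^+ 2 * gauss r a y)%:E)%E.
  by rewrite adde_ge0.
have m12 := emeasurable_funD m1 m2.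
have m3 := emeasurable_funD mh mgE.
have m4 := emeasurable_funD m12 muE.
have n3 y : (0 <= kl_integrand (gauss r a y) (u y) + (gauss r a y)%:E)%E by rewrite adde_ge0.
rewrite -(@leeD2rE _ 1%E)//.
apply: (@le_trans _ _ (\int[leb]_y (b%:E * (gauss r a y)%:E +
    C%:E * ((y - a) ^+ 2 * gauss r a y)%:E + (u y)%:E))%E); last first.
  rewrite ge0_integralTD// u1 leeD2r// ge0_integralTD//.
  rewrite !ge0_integralTZl// integral_gauss mule1 EFinD leeD2l// EFinM.
  by rewrite lee_wpmul2l// integral_sqr_gauss.
rewrite -[in leLHS](integral_gauss r a) -ge0_integralTD//.
apply: ge0_le_integralT => // y.
rewrite /kl_integrand gt_eqF// -!EFinM -!EFinD lee_fin.
have : gauss r a y * (ln (gauss r a y) - ln (u y)) <= gauss r a y * (b + C * (y - a) ^+ 2).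
  by rewrite ler_pM2l.
by lra.
Qed.

End gaussian_moments.

Section hybrid.
Context {R : realType}.
Local Notation leb := (@lebR R).
Implicit Types r a x y eps L : R.

Lemma integral_quad_gauss w a b C : 0 < w -> 0 <= b -> 0 <= C ->
  (\int[leb]_x ((b + C * (x - a) ^+ 2) * gauss w a x)%:E <= (b + C * (8 * w))%:E)%E.
Proof.
move=> w0 b0 C0.
have mgE : measurable_fun setT (fun y => (gauss w a y)%:E).
  by apply/measurable_EFinP; exact: measurable_gauss.
have msq : measurable_fun setT (fun y : R => ((y - a) ^+ 2 * gauss w a y)%:E).
  apply/measurable_EFinP; apply: measurable_funM; last exact: measurable_gauss.
  by apply: measurable_funX; exact: measurable_funB.
have g0 y : (0 <= (gauss w a y)%:E)%E by rewrite lee_fin ltW// gauss_gt0.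
have sq0 y : (0 <= ((y - a) ^+ 2 * gauss w a y)%:E)%E.
  by rewrite lee_fin mulr_ge0 ?sqr_ge0// ltW// gauss_gt0.
have bE : (0 <= b%:E)%E by rewrite lee_fin.
have CE : (0 <= C%:E)%E by rewrite lee_fin.
have n1 y : (0 <= b%:E * (gauss w a y)%:E)%E by rewrite mule_ge0.
have n2 y : (0 <= C%:E * ((y - a) ^+ 2 * gauss w a y)%:E)%E by rewrite mule_ge0.
have m1 : measurable_fun setT (fun y : R => b%:E * (gauss w a y)%:E)%E.
  exact: emeasurable_funM.
have m2 : measurable_fun setT (fun y : R => C%:E * ((y - a) ^+ 2 * gauss w a y)%:E)%E.
  exact: emeasurable_funM.
rewrite (eq_integral (fun x => b%:E * (gauss w a x)%:E +
    C%:E * ((x - a) ^+ 2 * gauss w a x)%:E)%E); last first.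
  by move=> x _; rewrite -!EFinM -EFinD; congr EFin; ring.
rewrite ge0_integralTD// !ge0_integralTZl// integral_gauss mule1 EFinD leeD2l//.
by rewrite EFinM lee_wpmul2l// integral_sqr_gauss.
Qed.

Lemma risk1_upper r a b C (q : R -> R -> R) : 0 < r -> 0 <= b -> 0 <= C ->
  measurable_fun setT (fun z : R * R => q z.1 z.2) ->
  (forall x y, 0 < q x y) ->
  (forall x, \int[leb]_y kl_integrand (gauss r a y) (q x y) <= (b + C * (x - a) ^+ 2)%:E)%E ->
  (risk1 r a q <= (b + C * 8)%:E)%E.
Proof.
move=> r0 b0 C0 mq q0 H.
have -> : b + C * 8 = b + C * (8 * 1) by rewrite mulr1.
apply: le_trans (integral_quad_gauss a ltr01 b0 C0).
apply: ge0_le_integralT => [x|||x].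
- rewrite mule_ge0 ?lee_fin ?(ltW (gauss_gt0 _ _ _))//; exact: kl_ge0.
- apply: emeasurable_funM; last by apply/measurable_EFinP; exact: measurable_gauss.
  exact: measurable_kl.
- apply/measurable_EFinP; apply: measurable_funM; last exact: measurable_gauss.
  apply: measurable_funD => //; apply: measurable_funM => //.
  by apply: measurable_funX; exact: measurable_funB.
- by rewrite EFinM lee_wpmul2r// lee_fin ltW// gauss_gt0.
Qed.

(* Bayes predictive density of the improper prior [delta_0 + eps * Lebesgue]. *)
Definition hybrid_pd r eps x y : R :=
  (gauss 1 0 x * gauss r 0 y + eps * gauss (1 + r) x y) / (gauss 1 0 x + eps).

Section hybrid_properties.
Variables (r eps : R).
Hypotheses (r0 : 0 < r) (e0 : 0 < eps).

Let r10 : 0 < 1 + r. Proof. by rewrite addr_gt0. Qed.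
Let den_gt0 x : 0 < gauss 1 0 x + eps. Proof. by rewrite addr_gt0// gauss_gt0. Qed.

Lemma hybrid_pd_gt0 x y : 0 < hybrid_pd r eps x y.
Proof. by rewrite divr_gt0// addr_gt0// mulr_gt0// gauss_gt0. Qed.

Lemma measurable_hybrid_pd :
  measurable_fun setT (fun z : R * R => hybrid_pd r eps z.1 z.2).
Proof.
apply: measurable_funM.
  apply: measurable_funD; apply: measurable_funM => //; exact: measurable_gauss.
apply: measurable_fun_inv; first by move=> z; exact: den_gt0.
by apply: measurable_funD => //; exact: measurable_gauss.
Qed.

Lemma integral_hybrid_pd x : (\int[leb]_y (hybrid_pd r eps x y)%:E = 1)%E.
Proof.
set c := gauss 1 0 x / (gauss 1 0 x + eps); set d := eps / (gauss 1 0 x + eps).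
have c0 : 0 <= c by rewrite divr_ge0 ?ltW// gauss_gt0.
have d0 : 0 <= d by rewrite divr_ge0 ?ltW// gauss_gt0.
have mg w a : 0 < w -> measurable_fun setT (fun y : R => (gauss w a y)%:E).
  by move=> w0; apply/measurable_EFinP; exact: measurable_gauss.
have g0 w a y : 0 < w -> (0 <= (gauss w a y)%:E)%E.
  by move=> w0; rewrite lee_fin ltW// gauss_gt0.
rewrite (eq_integral (fun y => c%:E * (gauss r 0 y)%:E + d%:E * (gauss (1 + r) x y)%:E)%E);
  last first.
  move=> y _; rewrite -!EFinM -EFinD; congr EFin; rewrite /hybrid_pd /c /d.
  by field; rewrite gt_eqF.
rewrite ge0_integralTD; last 4 first.
- by move=> y; rewrite mule_ge0 ?lee_fin// ltW// gauss_gt0.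
- by move=> y; rewrite mule_ge0 ?lee_fin// ltW// gauss_gt0.
- by apply: emeasurable_funM => //; exact: mg.
- by apply: emeasurable_funM => //; exact: mg.
rewrite !ge0_integralTZl ?lee_fin//; try exact: mg; try by move=> y; exact: g0.
rewrite !integral_gauss !mule1 -EFinD /c /d -mulrDl divff// gt_eqF//.
Qed.

(** Only one component of the mixture is kept, at the cost of minus the logarithm of its posterior
    weight, here [gauss 1 0 x / (gauss 1 0 x + eps)]; the next lemma does the same with the flat
    component. *)
Lemma hybrid_pd_ge_null x y :
  - ln (hybrid_pd r eps x y) <= - ln (gauss r 0 y) + ln (1 + eps / gauss 1 0 x).
Proof.
have p0 := @gauss_gt0 _ 1 0 x ltr01; have g0 := gauss_gt0 0 y r0.
have -> : 1 + eps / gauss 1 0 x = (gauss 1 0 x + eps) / gauss 1 0 x.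
  by field; rewrite gt_eqF.
have t0 : 0 < gauss 1 0 x / (gauss 1 0 x + eps) by rewrite divr_gt0.
rewrite -[X in _ + ln X]invf_div lnV ?posrE// -opprD lerN2 -lnM ?posrE//.
rewrite ler_ln ?posrE ?(mulr_gt0 g0 t0) ?hybrid_pd_gt0// /hybrid_pd.
rewrite mulrA (mulrC (gauss r 0 y)) ler_pM2r ?invr_gt0 ?den_gt0// lerDl.
by rewrite mulr_ge0 ?ltW// gauss_gt0.
Qed.

Lemma hybrid_pd_ge_flat x y :
  - ln (hybrid_pd r eps x y) <= - ln (gauss (1 + r) x y) + ln (1 + gauss 1 0 x / eps).
Proof.
have p0 := @gauss_gt0 _ 1 0 x ltr01; have g0 := gauss_gt0 x y r10.
have -> : 1 + gauss 1 0 x / eps = (gauss 1 0 x + eps) / eps.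
  by field; rewrite gt_eqF.
have t0 : 0 < eps / (gauss 1 0 x + eps) by rewrite divr_gt0.
rewrite -[X in _ + ln X]invf_div lnV ?posrE// -opprD lerN2 -lnM ?posrE//.
rewrite ler_ln ?posrE ?(mulr_gt0 g0 t0) ?hybrid_pd_gt0// /hybrid_pd.
rewrite mulrA (mulrC (gauss (1 + r) x y)) ler_pM2r ?invr_gt0 ?den_gt0// lerDr.
by rewrite mulr_ge0 ?ltW// gauss_gt0.
Qed.

End hybrid_properties.

End hybrid.

Section hybrid_risk.
Context {R : realType}.
Local Notation leb := (@lebR R).
Implicit Types r a x y L : R.

(** Used with [z] a centred Gaussian variable: at the scale [a ^+ 2 = 2 v L] the cross term costs an
    arbitrarily small multiple of [L] plus a constant on average. *)
Lemma amgm_delta (d a z : R) : 0 < d -> 2 * a * z <= d * a ^+ 2 + d^-1 * z ^+ 2.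
Proof.
move=> d0; rewrite -subr_ge0.
have -> : d * a ^+ 2 + d^-1 * z ^+ 2 - 2 * a * z = d^-1 * (d * a - z) ^+ 2.
  by field; rewrite gt_eqF.
by rewrite mulr_ge0 ?sqr_ge0// invr_ge0 ltW.
Qed.

Lemma ln2_le1 : ln 2 <= 1 :> R.
Proof. by have := @ln_ub_sub1 R 2 (ltr0Sn R 1); lra. Qed.

Lemma ln1_expR_le (s t : R) : s <= t -> 0 <= t -> ln (1 + expR s) <= 1 + t.
Proof.
move=> st t0.
apply: (@le_trans _ _ (ln (2 * expR t))).
  rewrite ler_ln ?posrE ?addr_gt0 ?mulr_gt0 ?expR_gt0//.
  have : expR s <= expR t by rewrite ler_expR.
  by have := expR_ge1Dx t; lra.
by rewrite lnM ?posrE ?expR_gt0// expRK lerD2r ln2_le1.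
Qed.

(** The last identity turns the cost [a ^+ 2 / (2 r)] of a mean at the threshold [a ^+ 2 = 2 v L]
    into [(1 - v) L]. *)
Lemma bg_v_eq r : 0 < r -> [/\ 0 < bg_v r, bg_v r < 1 & bg_v r = r * (1 - bg_v r)].
Proof.
move=> r0; have -> : bg_v r = r / (1 + r).
  by rewrite /bg_v; field; rewrite ?gt_eqF// addr_gt0.
have r1 : 0 < 1 + r by rewrite addr_gt0.
split; first by rewrite divr_gt0.
- by rewrite ltr_pdivrMr// mul1r ltrDr.
- by field; rewrite gt_eqF.
Qed.

Definition ln_peak (w : R) := ln (Num.sqrt (w * pi *+ 2)).

Lemma ln_peak1_ge0 : 0 <= ln_peak 1.
Proof.
rewrite /ln_peak ln_ge0// -[leLHS]sqrtr1 ler_wsqrtr// mul1r.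
by have := @pi_ge2 R; lra.
Qed.

Lemma gauss1_expR a x : gauss 1 a x = expR (- ln_peak 1 - (x - a) ^+ 2 / 2).
Proof.
have g0 : 0 < gauss 1 a x by exact: gauss_gt0.
by rewrite -[LHS](lnK (x := gauss 1 a x)) ?posrE// ln_gauss.
Qed.

(* For [a ^+ 2 <= 2 v L] the component N(0, r) of the mixture is close enough to
   the truth; for larger [a] it is N(x, 1 + r) that is. *)
Lemma risk1_hybrid_le r d : 0 < r -> 0 < d -> d < 1 -> (1 + d) * bg_v r <= 1 ->
  exists2 C : R, 0 <= C & forall L a, 0 <= L ->
    (risk1 r a (hybrid_pd r (expR (- L))) <= ((1 - bg_v r + d) * L + C)%:E)%E.
Proof.
move=> r0 d0 d1 dv; have [v0 v1 vr] := bg_v_eq r0; set v := bg_v r in dv v0 v1 vr *.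
have r1 : 0 < 1 + r by rewrite addr_gt0.
have di0 : 0 < d^-1 by rewrite invr_gt0.
have ri0 : 0 < r^-1 by rewrite invr_gt0.
pose c1 := `|ln_peak (1 + r) - ln_peak r|.
have c10 : 0 <= c1 by exact: normr_ge0.
(* [B] and [C] dominate, for both cases below, the additive constant and the coefficient of
   [(x - a) ^+ 2]; the factor [8 * r] comes from averaging [(y - a) ^+ 2]. *)
pose B := 1 + ln_peak 1 + c1 + (r^-1 * d^-1 / 2 + 1) * (8 * r).
pose C := (1 + d^-1) / 2 + 1.
have B0 : 0 <= B.
  have k1 : 0 <= r^-1 * d^-1 / 2 by apply: divr_ge0 => //; apply: mulr_ge0; exact: ltW.
  have k2 : 0 <= (r^-1 * d^-1 / 2 + 1) * (8 * r) by apply: mulr_ge0; lra.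
  by have := ln_peak1_ge0; rewrite /B; lra.
have C0 : 0 <= C by rewrite /C; lra.
exists (B + C * 8); first by rewrite addr_ge0// mulr_ge0.
move=> L a L0; set eps := expR (- L).
have e0 : 0 < eps by exact: expR_gt0.
have H : 0 <= (1 - v + d) * L by rewrite mulr_ge0//; lra.
rewrite addrA; apply: risk1_upper => //.
- by rewrite addr_ge0.
- exact: measurable_hybrid_pd.
- by move=> x y; exact: hybrid_pd_gt0.
move=> x.
have sq0 : 0 <= (x - a) ^+ 2 by exact: sqr_ge0.
have k1 : 0 <= (1 + d^-1) / 2 * (x - a) ^+ 2 by apply: mulr_ge0 => //; lra.
have k2 : 0 <= d^-1 / 2 * (x - a) ^+ 2 by apply: mulr_ge0 => //; lra.
have k3 : 0 <= r^-1 * d^-1 / 2.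
  by apply: divr_ge0 => //; apply: mulr_ge0; exact: ltW.
have k4 : 0 <= r^-1 * d^-1 / 2 * (8 * r) by apply: mulr_ge0 => //; lra.
have k5 := ln_peak1_ge0.
have am1 := amgm_delta a (x - a) d0.
have am2 := amgm_delta (- a) (x - a) d0.
have xx : x ^+ 2 = a ^+ 2 + 2 * a * (x - a) + (x - a) ^+ 2 by ring.
have [small|large] := leP (a ^+ 2) (2 * v * L).
  pose b := (1 - v + d) * L + (1 + ln_peak 1 + (1 + d^-1) / 2 * (x - a) ^+ 2).
  have b1 : 0 <= 1 + ln_peak 1 + (1 + d^-1) / 2 * (x - a) ^+ 2.
    by lra.
  apply: (@le_trans _ _ (b + (r^-1 * d^-1 / 2) * (8 * r))%:E).
    apply: kl_upper => //.
    - by rewrite /b addr_ge0.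
    - exact: (measurable_fun_comp2 (measurable_hybrid_pd r0 e0)).
    - by move=> y; exact: hybrid_pd_gt0.
    - exact: integral_hybrid_pd.
    move=> y; have := hybrid_pd_ge_null r0 e0 x y.
    have -> : eps / gauss 1 0 x = expR (- L + ln_peak 1 + x ^+ 2 / 2).
      rewrite gauss1_expR -expRN /eps -expRD subr0; congr expR; ring.
    (* Up to a multiple of [(x - a) ^+ 2], [x ^+ 2 / 2] is at most [(1 + d) * a ^+ 2 / 2 <= (1 + d)
       * v * L <= L], so the weight of the null component costs nothing of order [L]. *)
    have sp : ln (1 + expR (- L + ln_peak 1 + x ^+ 2 / 2)) <=
        1 + (ln_peak 1 + (1 + d^-1) / 2 * (x - a) ^+ 2).
      apply: ln1_expR_le; last first.
        by lra.
      have : (1 + d) * a ^+ 2 <= (1 + d) * (2 * v * L).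
        by rewrite ler_pM2l//; lra.
      have : (1 + d) * v * L <= 1 * L by rewrite ler_wpM2r.
      by lra.
    rewrite !ln_gauss// subr0 => Hq.
    have am3 := amgm_delta a (y - a) d0.
    (* Here the whole order [L] arises: [a ^+ 2 / (2 * r)] is at most [v * L / r = (1 - v) * L]. *)
    have e1 : (y ^+ 2 - (y - a) ^+ 2) / (r *+ 2) <=
        (1 - v + d) * L + r^-1 * d^-1 / 2 * (y - a) ^+ 2.
      have : (1 + d) * a ^+ 2 <= (1 + d) * (2 * v * L).
        by rewrite ler_pM2l//; lra.
      move=> h1.
      rewrite ler_pdivrMr ?pmulrn_lgt0//.
      have -> : ((1 - v + d) * L + r^-1 * d^-1 / 2 * (y - a) ^+ 2) * (r *+ 2) =
         2 * (r * (1 - v) + r * d) * L + d^-1 * (y - a) ^+ 2.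
        by field; rewrite ?gt_eqF.
      rewrite -vr.
      have : v * (d * L) <= r * (d * L).
        apply: ler_wpM2r; first by rewrite mulr_ge0// ltW.
        by have := mulr_gt0 r0 v0; lra.
      have -> : y ^+ 2 - (y - a) ^+ 2 = 2 * a * (y - a) + a ^+ 2 by ring.
      by lra.
    have -> : - ln (Num.sqrt (r * pi *+ 2)) - (y - a) ^+ 2 / (r *+ 2)
      - ln (hybrid_pd r eps x y) = - ln (Num.sqrt (r * pi *+ 2)) -
       (y - a) ^+ 2 / (r *+ 2) + (- ln (hybrid_pd r eps x y)) by ring.
    by rewrite /b; lra.
  rewrite lee_fin /b /B /C.
  by lra.
pose b := (1 - v + d) * L + (1 + c1 + (1 + d^-1 / 2) * (x - a) ^+ 2).
have b1 : 0 <= 1 + c1 + (1 + d^-1 / 2) * (x - a) ^+ 2.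
  by lra.
apply: (@le_trans _ _ (b + 1 * (8 * r))%:E).
  apply: kl_upper => //.
  - by rewrite /b addr_ge0.
  - exact: (measurable_fun_comp2 (measurable_hybrid_pd r0 e0)).
  - by move=> y; exact: hybrid_pd_gt0.
  - exact: integral_hybrid_pd.
  move=> y; have := hybrid_pd_ge_flat r0 e0 x y.
  have -> : gauss 1 0 x / eps = expR (L - ln_peak 1 - x ^+ 2 / 2).
    rewrite gauss1_expR -expRN /eps -expRD subr0; congr expR; ring.
  (* Now the order [L] comes from the weight: [x ^+ 2 / 2] is at least [(1 - d) * v * L] up to a
     multiple of [(x - a) ^+ 2], and [d * v <= d]. *)
  have sp : ln (1 + expR (L - ln_peak 1 - x ^+ 2 / 2)) <=
      1 + ((1 - v + d) * L + d^-1 / 2 * (x - a) ^+ 2).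
    apply: ln1_expR_le; last by lra.
    have : (1 - d) * (2 * v * L) <= (1 - d) * a ^+ 2.
      by rewrite ler_pM2l ?subr_gt0// ltW.
    have : d * L * v <= d * L * 1 by rewrite ler_wpM2l ?mulr_ge0// ltW.
    have := ln_peak1_ge0.
    by lra.
  rewrite !ln_gauss// => Hq.
  have e1 : (y - x) ^+ 2 / ((1 + r) *+ 2) <= (y - a) ^+ 2 + (x - a) ^+ 2.
    rewrite ler_pdivrMr ?pmulrn_lgt0//.
    have : 0 <= r * ((y - a) ^+ 2 + (x - a) ^+ 2).
      by rewrite mulr_ge0 ?addr_ge0 ?sqr_ge0 ?ltW.
    have := sqr_ge0 ((y - a) + (x - a)).
    by lra.
  have e2 : 0 <= (y - a) ^+ 2 / (r *+ 2).
    by rewrite divr_ge0 ?sqr_ge0// mulrn_wge0// ltW.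
  have e3 : ln_peak (1 + r) - ln_peak r <= c1 by exact: ler_norm.
  rewrite /ln_peak in e3.
  by rewrite /b; lra.
rewrite lee_fin /b /B /C.
by lra.
Qed.

End hybrid_risk.

Section hybrid_risk0.
Context {R : realType}.
Local Notation leb := (@lebR R).
Implicit Types r a x y L : R.

(** For [s <= 0] both [ln (1 + u) <= u] and [expR s <= expR (t * s)] apply; for [s > 0],
    [1 + expR s <= (1 + expR (s / 2)) ^+ 2]. The freedom in [t] matters in the next lemma. *)
Lemma ln1_expR_le_expR (s t : R) : 2^-1 <= t -> t <= 1 ->
  ln (1 + expR s) <= 2 * expR (t * s).
Proof.
move=> t1 t2; have [s0|s0] := leP s 0.
  apply: (@le_trans _ _ (expR s)).
    by apply: le_ln1Dx; apply: lt_trans (expR_gt0 s); lra.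
  have : expR s <= expR (t * s) by rewrite ler_expR; nra.
  by have := expR_gt0 (t * s); lra.
apply: (@le_trans _ _ (2 * expR (s / 2))); last first.
  by rewrite ler_pM2l// ler_expR; nra.
have h0 := expR_gt0 (s / 2).
apply: (@le_trans _ _ (ln ((1 + expR (s / 2)) ^+ 2))).
  rewrite ler_ln ?posrE ?exprn_gt0 ?addr_gt0 ?expR_gt0//.
  have -> : expR s = expR (s / 2) * expR (s / 2) by rewrite -expRD; congr expR; lra.
  by lra.
rewrite lnXn ?addr_gt0//.
have : ln (1 + expR (s / 2)) <= expR (s / 2) by apply: le_ln1Dx; lra.
by lra.
Qed.

(** The bound [ln (1 + u) <= u] would cancel the Gaussian weight and leave a constant, not
    integrable in [x]. The exponent [t = 1 - L^-1] loses only a factor [expR 1] on [expR (- L)] and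
    leaves [expR (- x ^+ 2 / (2 * L))], a Gaussian of variance [L]; its normalisation is the square
    root in the bound. *)
Lemma risk1_hybrid0 r L : 0 < r -> 2 <= L ->
  (risk1 r 0 (hybrid_pd r (expR (- L))) <=
    (2 * expR (1 - L) * Num.sqrt (L * pi *+ 2))%:E)%E.
Proof.
move=> r0 L2; set eps := expR (- L).
have L0 : 0 < L by lra.
have e0 : 0 < eps by exact: expR_gt0.
have s0 : 0 < Num.sqrt (L * pi *+ 2).
  by rewrite sqrtr_gt0 pmulrn_lgt0// mulr_gt0// pi_gt0.
set K := 2 * expR (1 - L) * Num.sqrt (L * pi *+ 2).
have K0 : 0 <= K by rewrite /K !mulr_ge0 ?expR_ge0 ?ltW.
have mg : measurable_fun setT (fun x : R => (gauss L 0 x)%:E).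
  by apply/measurable_EFinP; exact: measurable_gauss.
have -> : K%:E = (\int[leb]_x (K%:E * (gauss L 0 x)%:E))%E.
  rewrite ge0_integralTZl ?integral_gauss ?mule1//.
  by move=> x; rewrite lee_fin ltW// gauss_gt0.
apply: ge0_le_integralT => [x|||x].
- apply: mule_ge0; last by rewrite lee_fin ltW// gauss_gt0.
  by apply: kl_ge0 => // y z; exact: hybrid_pd_gt0.
- apply: emeasurable_funM; last by apply/measurable_EFinP; exact: measurable_gauss.
  apply: measurable_kl => //; first exact: measurable_hybrid_pd.
  by move=> y z; exact: hybrid_pd_gt0.
- exact: emeasurable_funM.
have g10 : 0 < gauss 1 0 x by exact: gauss_gt0.
have l0 : 0 <= ln (1 + eps / gauss 1 0 x).
  by rewrite ln_ge0// lerDl divr_ge0 ?ltW.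
apply: (@le_trans _ _ ((ln (1 + eps / gauss 1 0 x))%:E * (gauss 1 0 x)%:E)%E).
  apply: lee_wpmul2r; first by rewrite lee_fin ltW.
  apply: (@le_trans _ _ (ln (1 + eps / gauss 1 0 x) + 0 * (8 * r))%:E); last first.
    by rewrite mul0r addr0.
  apply: kl_upper => //.
  - exact: (measurable_fun_comp2 (measurable_hybrid_pd r0 e0)).
  - by move=> y; exact: hybrid_pd_gt0.
  - exact: integral_hybrid_pd.
  by move=> y; have := hybrid_pd_ge_null r0 e0 x y; lra.
rewrite -!EFinM lee_fin.
have -> : eps / gauss 1 0 x = expR (- L + ln_peak 1 + x ^+ 2 / 2).
  rewrite gauss1_expR -expRN /eps -expRD subr0; congr expR; ring.
have Li : 0 < L^-1 by rewrite invr_gt0.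
have Lii : L^-1 <= 2^-1 by rewrite lef_pV2 ?posrE.
apply: (@le_trans _ _ (2 * expR ((1 - L^-1) * (- L + ln_peak 1 + x ^+ 2 / 2)) * gauss 1 0 x)).
  by apply: ler_wpM2r; [exact: ltW|apply: ln1_expR_le_expR; lra].
rewrite gauss1_expR subr0 gaussE// subr0 /K.
rewrite -mulrA -expRD.
have -> : 2 * expR (1 - L) * Num.sqrt (L * pi *+ 2) *
   ((Num.sqrt (L * pi *+ 2))^-1 * expR (- x ^+ 2 / (L *+ 2))) =
   2 * (expR (1 - L) * expR (- x ^+ 2 / (L *+ 2))).
  by field; rewrite gt_eqF.
rewrite ler_pM2l// -expRD ler_expR.
have -> : (1 - L^-1) * (- L + ln_peak 1 + x ^+ 2 / 2) + (- ln_peak 1 - x ^+ 2 / 2) =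
  1 - L + - x ^+ 2 / (L *+ 2) - L^-1 * ln_peak 1 by field; rewrite gt_eqF.
rewrite gerBl mulr_ge0 ?ln_peak1_ge0 ?ltW//.
Qed.

End hybrid_risk0.

(** * Nonnegative functions with a known finite integral *)

Section real_integral.
Context d (T : measurableType d) (R : realType) (mu : {measure set T -> \bar R}).
Implicit Types (f g : T -> R) (I J : R).

Definition ge0_has_integral f I :=
  [/\ measurable_fun setT f, forall x, 0 <= f x &
      (\int[mu]_x (f x)%:E = I%:E)%E].

Lemma ge0_has_integralD f g I J : ge0_has_integral f I -> ge0_has_integral g J ->
  ge0_has_integral (fun x => f x + g x) (I + J).
Proof.
move=> [mf f0 fI] [mg g0 gJ]; split.
- exact: measurable_funD.
- by move=> x; rewrite addr_ge0.
- rewrite EFinD -fI -gJ -ge0_integralTD//.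
  + exact/measurable_EFinP.
  + exact/measurable_EFinP.
Qed.

Lemma ge0_has_integralZ k f I : 0 <= k -> ge0_has_integral f I ->
  ge0_has_integral (fun x => k * f x) (k * I).
Proof.
move=> k0 [mf f0 fI]; split.
- exact: measurable_funM.
- by move=> x; rewrite mulr_ge0.
- rewrite EFinM -fI -ge0_integralTZl//.
  + exact/measurable_EFinP.
Qed.

Lemma ge0_has_integral_le f g J (h : T -> \bar R) : ge0_has_integral g J ->
  measurable_fun setT f -> (forall x, 0 <= f x) ->
  measurable_fun setT h -> (forall x, 0 <= h x)%E ->
  (forall x, (f x)%:E <= h x + (g x)%:E)%E ->
  (\int[mu]_x (f x)%:E <= \int[mu]_x h x + J%:E)%E.
Proof.
move=> [mg g0 gJ] mf f0 mh h0 H.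
have mgE : measurable_fun setT (fun x => (g x)%:E) by exact/measurable_EFinP.
have gE0 x : (0 <= (g x)%:E)%E by rewrite lee_fin.
rewrite -gJ -ge0_integralTD//.
apply: ge0_le_integralT => //.
- exact/measurable_EFinP.
- exact: emeasurable_funD.
Qed.

End real_integral.

(** * Bayes risk at a barely detectable mean *)

Section bayes_risk1.
Context {R : realType}.
Local Notation leb := (@lebR R).
Implicit Types r a x y L : R.

Lemma gauss_has_integral w a : 0 < w -> ge0_has_integral leb (gauss w a) 1.
Proof.
move=> w0; split; [exact: measurable_gauss| |exact: integral_gauss].
by move=> x; rewrite ltW// gauss_gt0.
Qed.

Lemma sqr_gauss_has_integral w a : 0 < w ->
  exists2 I, I <= 8 * w & ge0_has_integral leb (fun x => (x - a) ^+ 2 * gauss w a x) I.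
Proof.
move=> w0.
have f0 x : 0 <= (x - a) ^+ 2 * gauss w a x by rewrite mulr_ge0 ?sqr_ge0// ltW// gauss_gt0.
have H := integral_sqr_gauss a w0.
have Hf : (\int[leb]_x ((x - a) ^+ 2 * gauss w a x)%:E)%E \is a fin_num.
  rewrite ge0_fin_numE; first exact: le_lt_trans H (ltry _).
  by apply: integral_ge0 => x _; rewrite lee_fin.
exists (fine (\int[leb]_x ((x - a) ^+ 2 * gauss w a x)%:E)%E).
  by rewrite -lee_fin fineK.
split => //; last by rewrite fineK.
apply: measurable_funM; last exact: measurable_gauss.
by apply: measurable_funX; exact: measurable_funB.
Qed.

Section fixed_prior.
Variables (r : R) (pi0 : {sigma_finite_measure set R -> \bar R}) (d L a : R).
Hypotheses (r0 : 0 < r) (pi0T : pi0 setT = 1%E).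
Hypotheses (d0 : 0 < d) (eta2 : expR (- L) <= 2^-1).
Hypothesis pi00 : ((1 - expR (- L))%:E <= pi0 [set 0%R])%E.
Hypothesis aL : a ^+ 2 = 2 * bg_v r * L.
Let v := bg_v r.
Let eta := expR (- L).

Let eta0 : 0 < eta. Proof. exact: expR_gt0. Qed.
Let pi0_gt0 : (0 < pi0 [set 0%R])%E.
Proof. by apply: lt_le_trans pi00; rewrite lte_fin; have := eta2; lra. Qed.
Let pi0_fin : pi0 [set 0%R] \is a fin_num.
Proof.
rewrite ge0_fin_numE//; apply: (@le_lt_trans _ _ 1%E); last exact: ltry.
by rewrite -pi0T; apply: le_measure; rewrite ?inE.
Qed.
Let c0 := fine (pi0 [set 0%R]).
Let c0E : c0%:E = pi0 [set 0%R]. Proof. by rewrite fineK. Qed.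
Let c0_ge : 1 - eta <= c0. Proof. by rewrite -lee_fin c0E. Qed.
Let c0_le1 : c0 <= 1.
Proof. by rewrite -lee_fin c0E -pi0T; apply: le_measure; rewrite ?inE. Qed.
Let M1 := marg1 pi0.
Let M2 := marg2 r pi0.
Let q := bayes_pd r pi0.
Let D0 x y := gauss 1 0 x * gauss r 0 y.

Let M1_ge x : c0 * gauss 1 0 x <= M1 x.
Proof.
rewrite -lee_fin marg1E// EFinM c0E muleC.
apply: (@ge0_integral_atom _ _ _ pi0 (fun t => (gauss 1 t x)%:E) 0) => //.
- by apply/measurable_EFinP; exact: measurable_gauss.
- by move=> t; rewrite lee_fin ltW// gauss_gt0.
Qed.

Let M2_ge x y : c0 * D0 x y <= M2 x y.
Proof.
rewrite -lee_fin marg2E// EFinM c0E muleC.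
apply: (@ge0_integral_atom _ _ _ pi0 (fun t => (gauss 1 t x * gauss r t y)%:E) 0) => //.
- by apply/measurable_EFinP; apply: measurable_funM; exact: measurable_gauss.
- by move=> t; rewrite lee_fin ltW// mulr_gt0// gauss_gt0.
Qed.

Let C1 := (2 * d)^-1.
Let C2 := (4 * d)^-1 * (r^-1) ^+ 2.
Let D := (1 - v - 6 * v * d) * L - 1.

(** [q] is [M2 / M1]. The atom at 0 gives [M1] at least half the null density. In [M2] the null part
    is at most [P * expR S], and the remainder [N] is kept as the ratio [N / P]. What is left is
    [L - a ^+ 2 / 2 = (1 - v) * L] with three cross terms, each costing
    [d * a ^+ 2 = 2 * v * d * L]; hence the [6] in [D]. *)
Let pointwise x y :
  D - C1 * (x - a) ^+ 2 - C2 * (y - a) ^+ 2 -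
    (M2 x y - c0 * D0 x y) / (gauss r a y * gauss 1 a x * eta) <=
  ln (gauss r a y) - ln (q x y).
Proof.
have [v0 v1 vr] := bg_v_eq r0; rewrite -/v in v0 v1 vr.
have m1 : 0 < M1 x by exact: marg1_gt0.
have m2 : 0 < M2 x y by exact: marg2_gt0.
have p0 : 0 < gauss r a y by exact: gauss_gt0.
have g0 : 0 < gauss 1 a x by exact: gauss_gt0.
have g00 : 0 < gauss 1 0 x by exact: gauss_gt0.
set P := gauss r a y * gauss 1 a x * eta.
have P0 : 0 < P by rewrite !mulr_gt0.
have lnP : ln P = ln (gauss r a y) + ln (gauss 1 a x) - L.
  by rewrite lnM ?posrE ?mulr_gt0// lnM ?posrE// expRK.
have D00 : 0 < D0 x y by rewrite mulr_gt0// gauss_gt0.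
set N := M2 x y - c0 * D0 x y.
have N0 : 0 <= N by rewrite subr_ge0.
set S := 2 * d * a ^+ 2 + (4 * d)^-1 * (x - a) ^+ 2 + C2 * (y - a) ^+ 2.
have S0 : 0 <= S.
  have i0 : 0 <= (4 * d)^-1 by rewrite invr_ge0 mulr_ge0// ltW.
  have k1 : 0 <= (4 * d)^-1 * (x - a) ^+ 2 by rewrite mulr_ge0// sqr_ge0.
  have k2 : 0 <= C2 * (y - a) ^+ 2 by apply: mulr_ge0; [apply: mulr_ge0|]; rewrite ?sqr_ge0.
  have k3 : 0 <= d * a ^+ 2 by rewrite mulr_ge0 ?sqr_ge0// ltW.
  by rewrite /S; lra.
have d20 : 0 < 2 * d by rewrite mulr_gt0.
have am1 := @amgm_delta _ (2 * d) (- a) (x - a) d20.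
have am2 := @amgm_delta _ (2 * d) (- a) ((y - a) / r) d20.
have er z : z / (r *+ 2) = r^-1 / 2 * z by field; rewrite gt_eqF.
have e1 (z : R) : z / (1 *+ 2) = 2^-1 * z by field.
have e4 : (4 * d)^-1 = (2 * d)^-1 / 2 by field; rewrite gt_eqF.
have ra : r^-1 * a ^+ 2 = 2 * (1 - v) * L.
  by rewrite aL -/v {1}vr; field; rewrite gt_eqF.
have aL' := aL; rewrite -/v in aL'.
have lnM1 : ln (gauss 1 0 x) - 1 <= ln (M1 x).
  apply: (@le_trans _ _ (ln (2^-1 * gauss 1 0 x))).
    rewrite lnM ?posrE ?invr_gt0// lnV ?posrE//.
    by have := @ln2_le1 R; lra.
  rewrite ler_ln ?posrE ?mulr_gt0 ?invr_gt0//.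
  apply: le_trans (M1_ge x); rewrite ler_pM2r//.
  by have := c0_ge; have := eta2; rewrite -/eta; lra.
(* By the choice of [a], [a ^+ 2 / 2 + a ^+ 2 / (2 * r)] equals [L]: the terms of order [L] cancel,
   and only the two cross terms bounded by [S] survive. *)
have D0_le : ln (D0 x y) <= ln P + S.
  rewrite lnP /D0 lnM ?posrE ?gauss_gt0// !ln_gauss// !subr0 !er !e1.
  by rewrite /S /C2 e4; lra.
have D0_le' : D0 x y <= P * expR S.
  have PS : 0 < P * expR S by rewrite mulr_gt0// expR_gt0.
  rewrite -ler_ln ?posrE//.
  by rewrite lnM ?posrE ?expR_gt0// expRK.
have lnM2 : ln (M2 x y) <= ln P + S + N / P.
  have PN : 0 < 1 + N / P by rewrite ltr_wpDr// divr_ge0// ltW.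
  apply: (@le_trans _ _ (ln (P * expR S * (1 + N / P)))).
    have PP : 0 < P * expR S * (1 + N / P) by rewrite !mulr_gt0// expR_gt0.
    rewrite ler_ln ?posrE//.
    have eS := expR_ge1Dx S.
    have -> : P * expR S * (1 + N / P) = P * expR S + expR S * N.
      by field; rewrite gt_eqF.
    have N1 : N <= expR S * N by rewrite ler_peMl//; lra.
    have : c0 * D0 x y <= 1 * D0 x y by rewrite ler_pM2r.
    by move: N1 D0_le'; rewrite {1}/N; lra.
  rewrite lnM ?posrE ?mulr_gt0 ?expR_gt0// lnM ?posrE ?expR_gt0//.
  rewrite expRK lerD2l.
  have NP : 0 <= N / P by rewrite divr_ge0// ltW.
  by apply: le_ln1Dx; lra.
rewrite /q /bayes_pd -/(M1 x) -/(M2 x y) ln_div ?posrE//.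
move: lnM1 lnM2; rewrite lnP (ln_gauss 0 x)// (ln_gauss a x)// subr0 !e1.
rewrite /D /C1 /S e4; set HH := N / P => lnM1 lnM2.
have am3 := @amgm_delta _ (2 * d) a (x - a) d20.
have da : d * a ^+ 2 = d * (2 * v * L) by rewrite aL'.
by lra.
Qed.

(** [pointwise] averaged under the mean [a]. The quadratic terms give [8 * C1] and [8 * r * C2]. The
    average of [N / P] is [(1 - c0) / eta <= 1], because [P] is [eta] times the sampling density and
    [N] has total mass [1 - c0]. *)
Lemma risk1_bayes_ge_aux : 0 <= D ->
  (D%:E <= risk1 r a q + (8 * C1 + 8 * r * C2 + 1)%:E)%E.
Proof.
move=> D_ge0.
have mq : measurable_fun setT (fun z : R * R => q z.1 z.2).
  exact: measurable_bayes_pd.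
have q0 x y : 0 < q x y by exact: bayes_pd_gt0.
have C1_ge0 : 0 <= C1 by rewrite invr_ge0 mulr_ge0// ltW.
have C2_ge0 : 0 <= C2.
  by rewrite mulr_ge0 ?sqr_ge0// invr_ge0 mulr_ge0// ltW.
have c0_ge0 : 0 <= c0 by have := c0_ge; have := eta2; rewrite -/eta; lra.
have g1 x : 0 < gauss 1 a x by exact: gauss_gt0.
have [I1 I1le hI1] := @sqr_gauss_has_integral 1 a ltr01.
have [Ir Irle hIr] := @sqr_gauss_has_integral r a r0.
have inv_ge0 x : 0 <= (gauss 1 a x * eta)^-1 by rewrite invr_ge0 mulr_ge0 ?ltW.
have hM2 x : ge0_has_integral leb (M2 x) (M1 x).
  split; [| |exact: integral_marg2].
    exact: (measurable_fun_comp2 (measurable_marg2 r0 pi0T)).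
  by move=> y; exact/ltW/marg2_gt0.
have hM1 : ge0_has_integral leb M1 1.
  split; [exact: measurable_marg1| |exact: integral_marg1].
  by move=> y; exact/ltW/marg1_gt0.
have hq x : ge0_has_integral leb (q x) 1.
  split; [exact: (measurable_fun_comp2 mq)| |exact: integral_bayes_pd].
  by move=> y; exact/ltW.
have hD0 x : ge0_has_integral leb (D0 x) (gauss 1 0 x).
  rewrite -[X in ge0_has_integral _ _ X]mulr1.
  by apply: ge0_has_integralZ; [exact/ltW/gauss_gt0|exact: gauss_has_integral].
(* [M2 - c0 D0], the contribution of the nonzero means, is split with [c0 D0]
   moved to the left-hand side, so that only nonnegative functions are
   integrated. *)
have step x : ((D + c0 * gauss 1 0 x / (gauss 1 a x * eta))%:E <=
  \int[leb]_y kl_integrand (gauss r a y) (q x y) +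
   (C1 * (x - a) ^+ 2 + C2 * Ir + M1 x / (gauss 1 a x * eta))%:E)%E.
  pose f y := D * gauss r a y + q x y + c0 / (gauss 1 a x * eta) * D0 x y.
  pose g y := (C1 * (x - a) ^+ 2 + 1) * gauss r a y + C2 * ((y - a) ^+ 2 * gauss r a y) +
    (gauss 1 a x * eta)^-1 * M2 x y.
  have hf : ge0_has_integral leb f (D * 1 + 1 + c0 / (gauss 1 a x * eta) * gauss 1 0 x).
    apply: ge0_has_integralD.
      apply: ge0_has_integralD => //.
      by apply: ge0_has_integralZ => //; exact: gauss_has_integral.
    by apply: ge0_has_integralZ => //; rewrite mulr_ge0.
  have hg : ge0_has_integral leb g ((C1 * (x - a) ^+ 2 + 1) * 1 + C2 * Ir +
      (gauss 1 a x * eta)^-1 * M1 x).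
    apply: ge0_has_integralD.
      apply: ge0_has_integralD; apply: ge0_has_integralZ => //.
        by rewrite addr_ge0// mulr_ge0// sqr_ge0.
      exact: gauss_has_integral.
    exact: ge0_has_integralZ.
  rewrite -(@leeD2rE _ 1%E)// -EFinD -addeA -EFinD.
  have -> : D + c0 * gauss 1 0 x / (gauss 1 a x * eta) + 1 =
    D * 1 + 1 + c0 / (gauss 1 a x * eta) * gauss 1 0 x by ring.
  have -> : C1 * (x - a) ^+ 2 + C2 * Ir + M1 x / (gauss 1 a x * eta) + 1 =
    (C1 * (x - a) ^+ 2 + 1) * 1 + C2 * Ir + (gauss 1 a x * eta)^-1 * M1 x by ring.
  have [mf f0 <-] := hf.
  apply: (ge0_has_integral_le hg) => // [|y|y].
  - apply: measurable_kl_integrand; first exact: measurable_gauss.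
    exact: (measurable_fun_comp2 mq).
  - by apply: kl_integrand_ge0; [exact: gauss_gt0|exact: ltW].
  have p0 : 0 < gauss r a y by exact: gauss_gt0.
  rewrite /kl_integrand gt_eqF// -EFinD lee_fin.
  rewrite /f /g; move: (ler_wpM2l (ltW p0) (pointwise x y)).
  have -> : gauss r a y * (D - C1 * (x - a) ^+ 2 - C2 * (y - a) ^+ 2 -
      (M2 x y - c0 * D0 x y) / (gauss r a y * gauss 1 a x * eta)) =
    gauss r a y * (D - C1 * (x - a) ^+ 2 - C2 * (y - a) ^+ 2) -
      (gauss 1 a x * eta)^-1 * M2 x y + c0 / (gauss 1 a x * eta) * D0 x y.
    by field; rewrite !gt_eqF.
  by lra.
pose f x := D * gauss 1 a x + c0 / eta * gauss 1 0 x.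
pose g x := C1 * ((x - a) ^+ 2 * gauss 1 a x) + C2 * Ir * gauss 1 a x + eta^-1 * M1 x.
have ei : 0 <= eta^-1 by rewrite invr_ge0 ltW.
have Ir0 : 0 <= Ir.
  case: hIr => _ h0 hI; rewrite -lee_fin -hI; apply: integral_ge0 => y _.
  by rewrite lee_fin.
have hf : ge0_has_integral leb f (D * 1 + c0 / eta * 1).
  apply: ge0_has_integralD; apply: ge0_has_integralZ => //; try exact: gauss_has_integral.
  by rewrite mulr_ge0.
have hg : ge0_has_integral leb g (C1 * I1 + C2 * Ir * 1 + eta^-1 * 1).
  apply: ge0_has_integralD; last exact: ge0_has_integralZ.
  apply: ge0_has_integralD; apply: ge0_has_integralZ => //; first by rewrite mulr_ge0.
  exact: gauss_has_integral.
have [mf f0 fI] := hf.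
have := @ge0_has_integral_le _ _ _ leb f g _
  (fun x => (\int[leb]_y kl_integrand (gauss r a y) (q x y)) * (gauss 1 a x)%:E)%E hg mf f0.
rewrite fI -/(risk1 r a q) => H.
have : ((D * 1 + c0 / eta * 1)%:E <= risk1 r a q + (C1 * I1 + C2 * Ir * 1 + eta^-1 * 1)%:E)%E.
  apply: H => [|x|x].
  - apply: emeasurable_funM; last by apply/measurable_EFinP; exact: measurable_gauss.
    exact: measurable_kl.
  - by apply: mule_ge0; [exact: kl_ge0|rewrite lee_fin ltW].
  have m1 : 0 < M1 x by exact: marg1_gt0.
  have := step x; rewrite -(@lee_pmul2r _ (gauss 1 a x)%:E) ?lte_fin//.
  rewrite ge0_muleDl; last 2 first.
  - exact: kl_ge0.
  - rewrite lee_fin; apply: addr_ge0.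
      by apply: addr_ge0; apply: mulr_ge0 => //; exact: sqr_ge0.
    by apply: mulr_ge0 => //; exact: ltW.
  rewrite -!EFinM.
  have -> : (D + c0 * gauss 1 0 x / (gauss 1 a x * eta)) * gauss 1 a x = f x.
    by rewrite /f; field; rewrite !gt_eqF.
  have -> // : (C1 * (x - a) ^+ 2 + C2 * Ir + M1 x / (gauss 1 a x * eta)) * gauss 1 a x = g x.
  by rewrite /g; field; rewrite !gt_eqF.
move: (risk1_ge0 r0 q0 a); case: (risk1 r a q) => [rho _|_ _|//]; last first.
  by rewrite addye// leey.
rewrite -!EFinD !lee_fin => K.
have : (1 - c0) / eta <= 1 by rewrite ler_pdivrMr// mul1r; have := c0_ge; lra.
have : C2 * Ir <= C2 * (8 * r) by rewrite ler_wpM2l.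
have : C1 * I1 <= C1 * (8 * 1) by rewrite ler_wpM2l.
by lra.
Qed.

End fixed_prior.

Lemma risk1_bayes_ge r e : 0 < r -> 0 < e ->
  exists2 C : R, 0 <= C &
    forall (pi0 : {sigma_finite_measure set R -> \bar R}) L a,
    pi0 setT = 1%E -> 0 <= L -> expR (- L) <= 2^-1 ->
    ((1 - expR (- L))%:E <= pi0 [set 0%R])%E -> a ^+ 2 = 2 * bg_v r * L ->
    (((1 - bg_v r - e) * L - C)%:E <= risk1 r a (bayes_pd r pi0))%E.
Proof.
move=> r0 e0; have [v0 v1 vr] := bg_v_eq r0.
(* This makes the loss [6 * v * d] at most [e]. If [D] is negative, nonnegativity of the risk
   already gives the claim. *)
pose d := e / 6; have d0 : 0 < d by rewrite divr_gt0.
pose c := 8 * (2 * d)^-1 + 8 * r * ((4 * d)^-1 * (r^-1) ^+ 2) + 1.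
have c0 : 0 <= c.
  have k1 : 0 <= (2 * d)^-1 by rewrite invr_ge0 mulr_ge0// ltW.
  have k2 : 0 <= r * ((4 * d)^-1 * (r^-1) ^+ 2).
    apply: mulr_ge0; first exact: ltW.
    by rewrite mulr_ge0 ?sqr_ge0// invr_ge0 mulr_ge0// ltW.
  by rewrite /c; lra.
exists (c + 1); first by lra.
move=> pi0 L a pi0T L0 eta2 pi00 aL.
have pi0_gt0 : (0 < pi0 [set 0%R])%E.
  by apply: lt_le_trans pi00; rewrite lte_fin; lra.
have rk0 : (0 <= risk1 r a (bayes_pd r pi0))%E.
  by apply: risk1_ge0 => // x y; exact: bayes_pd_gt0.
have vL : e * L * bg_v r <= e * L * 1.
  by apply: ler_wpM2l; [rewrite mulr_ge0// ltW|exact: ltW].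
have [Dneg|Dpos] := ltP ((1 - bg_v r - 6 * bg_v r * d) * L - 1) 0.
  apply: le_trans rk0; rewrite lee_fin; move: Dneg; rewrite /d; lra.
have := risk1_bayes_ge_aux r0 pi0T d0 eta2 pi00 aL Dpos.
rewrite -/c; case: (risk1 r a _) rk0 => [rho _|_ _|//]; last by rewrite leey.
by rewrite -EFinD !lee_fin; rewrite /d; lra.
Qed.

End bayes_risk1.

(** * The bi-grid prior *)

Section bigrid_theory.
Context {R : realType}.
Variables (r : R).
Hypothesis r0 : 0 < r.
Local Open Scope ereal_scope.
Implicit Types (L eta : R).

Let v := bg_v r.
Let b := bg_b r.

Lemma bg_v_gt0 : (0 < bg_v r)%R.
Proof. by rewrite invr_gt0 addr_gt0// invr_gt0. Qed.

Lemma bg_b_gt0 : (0 < bg_b r)%R.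
Proof.
by rewrite lt_min ltr01 andbT !mulr_gt0 ?invr_gt0 ?addr_gt0 ?mulr_gt0.
Qed.

Lemma bg_b_le1 : (bg_b r <= 1)%R.
Proof. by rewrite ge_min lexx orbT. Qed.

Lemma bigrid_unnormalized_measure eta :
  {mu : {measure set R -> \bar R} | mu = bigrid_unnormalized r eta :> (set R -> \bar R)}.
Proof.
pose w1 k : {nonneg R} := NngNum (powR_ge0 eta ((k.+1%:R - 1) * v * b ^+ 2)).
pose w2 : {nonneg R} := NngNum (powR_ge0 eta (((bg_K r)%:R - 1) * v * b ^+ 2)).
pose w3 j : {nonneg R} := NngNum (powR_ge0 eta (j%:R * v)).
pose m1 := msum (fun k => mscale (w1 k) (\d_(bg_nu r eta k.+1) : {measure set R -> \bar R}))
  (bg_K r).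
pose m2 := mscale w2 (mseries (fun j => mscale (w3 j)
  (\d_(bg_mu r eta j) : {measure set R -> \bar R})) 1).
exists (measure_add m1 m2); apply/funext => A.
transitivity (m1 A + m2 A); first exact: measure_addE.
rewrite /m1 /m2 /msum /mscale /mseries /= /bigrid_unnormalized.
congr (_ + _).
by rewrite big_add1 /= big_mkord.
Qed.

Lemma bigrid_pos_measure eta :
  {mu : {measure set R -> \bar R} | mu = bigrid_pos r eta :> (set R -> \bar R)}.
Proof.
have [U UE] := bigrid_unnormalized_measure eta.
have Z0 : (0 <= (fine (bigrid_unnormalized r eta setT))^-1)%R.
  by rewrite invr_ge0 fine_ge0// -UE.
exists (mscale (NngNum Z0) U); apply/funext => A.
have UA : U A = bigrid_unnormalized r eta A by rewrite UE.
by rewrite /bigrid_pos -UA.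
Qed.

Lemma bigrid_prior_measure eta : (0 <= eta <= 1)%R ->
  {mu : {measure set R -> \bar R} | mu = bigrid_prior r eta :> (set R -> \bar R)}.
Proof.
move=> /andP[eta0 eta1].
have [P PE] := bigrid_pos_measure eta.
have w1 : (0 <= 1 - eta)%R by rewrite subr_ge0.
have w2 : (0 <= 2^-1 * eta)%R by rewrite mulr_ge0.
have mN : measurable_fun setT (-%R : R -> R) by exact: measurable_funN.
pose N : {measure set R -> \bar R} :=
  measure_function_pushforward__canonical__measure_function_Measure P mN.
exists (measure_add (mscale (NngNum w1) (\d_(0%R : R) : {measure set R -> \bar R}))
  (mscale (NngNum w2) (measure_add P N))).
apply/funext => A.
transitivity (mscale (NngNum w1) (\d_(0%R : R) : {measure set R -> \bar R}) A +
  mscale (NngNum w2) (measure_add P N) A); first exact: measure_addE.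
have NE : N A = bigrid_neg r eta A by rewrite /bigrid_neg -PE.
by rewrite /bigrid_prior -NE -PE -(measure_addE P N A).
Qed.

Section mass.
Variable L : R.
Hypothesis L0 : (0 <= L)%R.
Let eta := expR (- L).
(** The largest unnormalized weight after the first: it is the weight at [k = 2], and the tail ratio
    [eta^v] is no larger because [b <= 1]. *)
Let x := expR (- (v * b ^+ 2 * L)).
Hypothesis x2 : (x <= 2^-1)%R.

Let eta_pow p : (eta `^ p = expR (- (p * L)))%R.
Proof. by rewrite /powR gt_eqF ?expR_gt0// expRK mulrN. Qed.

Let vb_gt0 : (0 < v * b ^+ 2)%R.
Proof. by rewrite mulr_gt0 ?bg_v_gt0// exprn_gt0// bg_b_gt0. Qed.

Let pow_lex p : (1 <= p)%R -> (eta `^ (p * v * b ^+ 2) <= x)%R.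
Proof.
move=> p1; rewrite eta_pow ler_expR lerN2 -subr_ge0.
have -> : (p * v * b ^+ 2 * L - v * b ^+ 2 * L = (p - 1) * (v * b ^+ 2 * L))%R by ring.
by rewrite mulr_ge0 ?subr_ge0// mulr_ge0// ltW.
Qed.

Let yx : (eta `^ v <= x)%R.
Proof.
have b1 : (b ^+ 2 <= 1)%R by rewrite exprn_ile1 ?bg_b_le1 ?ltW ?bg_b_gt0.
rewrite eta_pow ler_expR lerN2 -subr_ge0.
have -> : (v * L - v * b ^+ 2 * L = (1 - b ^+ 2) * (v * L))%R by ring.
by rewrite mulr_ge0 ?subr_ge0// mulr_ge0// ltW// bg_v_gt0.
Qed.

Lemma bigrid_tail_le :
  \sum_(1 <= j <oo) (eta `^ (j%:R * v))%:E <= (2 * x)%:E.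
Proof.
apply: lime_le.
  by apply: is_cvg_nneseries => j _ _; rewrite lee_fin powR_ge0.
apply: nearW => n.
set y := (eta `^ v)%R.
have yx' : (y <= x)%R := yx.
have y0 : (0 <= y)%R by exact: powR_ge0.
have yj j : (eta `^ (j%:R * v) = y ^+ j)%R.
  by rewrite mulrC powRrM powR_mulrn.
under eq_bigr do rewrite yj.
rewrite sumEFin lee_fin.
case: n => [|n]; first by rewrite big_geq// mulr_ge0// expR_ge0.
rewrite big_add1 /=.
(* The subtracted term makes the bound inductive, since [y <= 2^-1]. *)
suff : (\sum_(0 <= j < n) y ^+ j.+1 <= 2 * y - 2 * y ^+ n.+1)%R.
  have : (0 <= y ^+ n.+1)%R by rewrite exprn_ge0.
  by move=> yn S; lra.
elim: n => [|n IH]; first by rewrite big_geq// expr1; lra.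
rewrite big_nat_recr//=.
have : (y ^+ n.+1 * y <= y ^+ n.+1 * 2^-1)%R.
  by apply: ler_wpM2l; [exact: exprn_ge0|exact: le_trans yx' x2].
rewrite -exprSr => yy; lra.
Qed.

Let K1 : (bg_K r = `|Num.ceil (2 * b `^ (- (3 / 2)))|.+1)%N.
Proof. by rewrite /bg_K add1n. Qed.

Lemma bigrid_first A : (\d_(bg_lambda r eta) A : \bar R) <= bigrid_unnormalized r eta A.
Proof.
rewrite /bigrid_unnormalized K1 big_ltn// !subrr !mul0r powRr0 mul1e.
have -> : bg_nu r eta 1 = bg_lambda r eta by rewrite /bg_nu subrr !mul0r addr0.
rewrite -[leLHS]adde0 -addeA leeD2l// adde_ge0//.
  by apply: sume_ge0 => k _; rewrite mule_ge0// lee_fin powR_ge0.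
rewrite mule_ge0 ?lee_fin ?powR_ge0//; apply: nneseries_ge0 => j _ _.
by rewrite mule_ge0// lee_fin powR_ge0.
Qed.

(** The first weight is 1, the [bg_K r - 1] others are at most [x] each, and the tail adds at most
    [2 * x]; this explains the factor [(bg_K r).+1]. *)
Lemma bigrid_total_le :
  bigrid_unnormalized r eta setT <= (1 + (bg_K r).+1%:R * x)%:E.
Proof.
rewrite /bigrid_unnormalized.
under eq_bigr do rewrite diracT mule1.
under eq_eseriesr do rewrite diracT mule1.
have -> : (1 + (bg_K r).+1%:R * x)%:E = (1 + (bg_K r).-1%:R * x)%:E + (2 * x)%:E.
  by rewrite -EFinD; congr EFin; rewrite K1 /= -[_.+2]addn2 natrD; ring.
apply: leeD.
  rewrite sumEFin lee_fin K1 big_ltn// !subrr !mul0r powRr0 lerD2l.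
  apply: (@le_trans _ _ (\sum_(2 <= k < (bg_K r).+1) x)%R).
    rewrite -K1 !big_nat; apply: ler_sum => k /andP[k2 _].
    have : (2%:R <= k%:R :> R)%R by rewrite ler_nat.
    by move=> k2R; apply: pow_lex; lra.
  by rewrite sumr_const_nat mulr_natl K1 /= !subSS subn0.
rewrite -[leRHS]mul1e; apply: lee_pmul.
- by rewrite lee_fin powR_ge0.
- by apply: nneseries_ge0 => j _ _; rewrite lee_fin powR_ge0.
- rewrite lee_fin eta_pow expR_le1 oppr_le0.
  have k0 : (0 <= (bg_K r)%:R - 1 :> R)%R by rewrite K1 -natr1 addrK ler0n.
  have -> : (((bg_K r)%:R - 1) * v * b ^+ 2 * L =
    ((bg_K r)%:R - 1) * (v * b ^+ 2 * L))%R by ring.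
  by apply: mulr_ge0 => //; apply: mulr_ge0 => //; exact: ltW.
- exact: bigrid_tail_le.
Qed.

Let Z := fine (bigrid_unnormalized r eta setT).

Let U_fin : bigrid_unnormalized r eta setT \is a fin_num.
Proof.
rewrite ge0_fin_numE; first exact: le_lt_trans bigrid_total_le (ltry _).
by apply: le_trans (bigrid_first setT); rewrite diracT.
Qed.

Let Z1 : (1 <= Z)%R.
Proof. by rewrite -lee_fin fineK// (le_trans _ (bigrid_first setT))// diracT. Qed.

Let Zle : (Z <= 1 + (bg_K r).+1%:R * x)%R.
Proof. by rewrite -lee_fin fineK// bigrid_total_le. Qed.

Lemma bigrid_posT : bigrid_pos r eta setT = 1.
Proof.
rewrite /bigrid_pos -/Z -(fineK U_fin) -/Z -EFinM mulVf//.
by rewrite gt_eqF// (lt_le_trans ltr01).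
Qed.

(** The unnormalized mass at [bg_lambda] is at least 1, and the total [Z] is at most [1 + k * x],
    whose inverse is at least [1 - k * x]. *)
Lemma bigrid_pos_lambda A : A (bg_lambda r eta) ->
  (1 - (bg_K r).+1%:R * x)%:E <= bigrid_pos r eta A.
Proof.
move=> lA; rewrite /bigrid_pos -/Z.
have Z0 : (0 < Z)%R by rewrite (lt_le_trans ltr01).
apply: (@le_trans _ _ (Z^-1%:E * 1)); last first.
  apply: lee_wpmul2l; first by rewrite lee_fin invr_ge0 ltW.
  by apply: le_trans (bigrid_first A); rewrite diracE mem_set.
rewrite mule1 lee_fin -[leRHS]mul1r ler_pdivlMr//.
set k := (bg_K r).+1%:R.
have Zle' : (Z <= 1 + k * x)%R := Zle.
have k0 : (0 <= k)%R by exact: ler0n.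
have x0 : (0 <= x)%R by exact: expR_ge0.
have [neg|pos] := leP (1 - k * x)%R 0%R.
  by have := mulr_le0_ge0 neg (ltW Z0); lra.
apply: (@le_trans _ _ ((1 - k * x) * (1 + k * x))%R); first by rewrite ler_pM2l.
by have := sqr_ge0 (k * x)%R; lra.
Qed.

Let eta01 : (0 <= eta <= 1)%R.
Proof. by rewrite expR_ge0 /= expR_le1 oppr_le0. Qed.

Lemma bigrid_negT : bigrid_neg r eta setT = 1.
Proof. by rewrite /bigrid_neg /pushforward preimage_setT bigrid_posT. Qed.

Lemma bigrid_priorT : bigrid_prior r eta setT = 1.
Proof.
rewrite /bigrid_prior bigrid_posT bigrid_negT diracT mule1.
have -> : 1 + 1 = (1 + 1)%:E :> \bar R by rewrite EFinD.
by rewrite -EFinM -EFinD; congr EFin; lra.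
Qed.

Lemma bigrid_pos_ge0 A : 0 <= bigrid_pos r eta A.
Proof. by have [P PE] := bigrid_pos_measure eta; rewrite -PE. Qed.

Lemma bigrid_prior0 : (1 - eta)%:E <= bigrid_prior r eta [set 0%R].
Proof.
have /andP[e0 e1] := eta01.
rewrite /bigrid_prior diracE mem_set// mule1 leeDl// mule_ge0//.
  by rewrite lee_fin mulr_ge0.
by rewrite adde_ge0// bigrid_pos_ge0.
Qed.

Lemma bigrid_prior_lambda A : A (bg_lambda r eta) -> A (- bg_lambda r eta)%R ->
  (eta * (1 - (bg_K r).+1%:R * x))%:E <= bigrid_prior r eta A.
Proof.
move=> lA nA; have /andP[e0 e1] := eta01.
set y := (1 - _)%R.
have -> : (eta * y)%:E = 0 + (2^-1 * eta)%:E * (y%:E + y%:E).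
  by rewrite add0e -EFinD -EFinM; congr EFin; lra.
apply: leeD; first by rewrite mule_ge0// lee_fin subr_ge0.
apply: lee_wpmul2l; first by rewrite lee_fin mulr_ge0.
by apply: leeD; exact: bigrid_pos_lambda.
Qed.

Lemma bigrid_prior_sigma_finite :
  {mu : {sigma_finite_measure set R -> \bar R} |
    mu = bigrid_prior r eta :> (set R -> \bar R)}.
Proof.
have [M ME] := bigrid_prior_measure eta01.
have MT : M setT = 1 by rewrite ME bigrid_priorT.
have [mu muE] : {mu : set R -> \bar R | mu = M} by exists M.
have s0 : mu set0 = 0 by rewrite muE.
have sge0 A : 0 <= mu A by rewrite muE.
have sadd : semi_sigma_additive mu by rewrite muE; exact: measure_semi_sigma_additive.
pose M' : {measure set R -> \bar R} := HB.pack mu (isMeasure.Build _ _ _ _ s0 sge0 sadd).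
have sf : sigma_finite setT M'.
  exists (fun _ => setT); first by rewrite bigcup_const.
  by move=> _; split => //; rewrite /= muE MT ltry.
pose S : {sigma_finite_measure set R -> \bar R} :=
  HB.pack (Measure.sort M') (Measure.class M') (Measure_isSigmaFinite.Build _ _ _ M' sf).
by exists S; rewrite /= muE.
Qed.

Lemma bg_lambda_sqr : (bg_lambda r eta ^+ 2 = 2 * bg_v r * L)%R.
Proof.
rewrite /bg_lambda eta_pow expRK sqr_sqrtr; first by ring.
by rewrite mulNr opprK !mulr_ge0// ltW// bg_v_gt0.
Qed.

End mass.
End bigrid_theory.

(** * Number of nonzero coordinates *)

Section counting.
Context {R : realType}.
Variable pi0 : {sigma_finite_measure set R -> \bar R}.
Hypothesis pi0T : pi0 setT = 1%E.
Local Notation Pi n := (mpow pi0 n).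

Lemma mpowT n : Pi n setT = 1%E.
Proof.
have e k : Pi k setT = (\int[Pi k]_t (cst 1 t))%E by rewrite integral_cst//= mul1e.
elim: n => [|n IH]; rewrite e; first by rewrite integral_mpow0.
rewrite integral_mpowS//; under eq_integral do rewrite -e IH.
by rewrite integral_cst//= pi0T mule1.
Qed.

Lemma ge0_has_integral_mpowS n (f : n.+1.-tuple R -> R) (I : R -> R) J :
  measurable_fun setT f -> (forall t, 0 <= f t) ->
  (forall x, ge0_has_integral (Pi n) (fun t => f [tuple of x :: t]) (I x)) ->
  ge0_has_integral pi0 I J -> ge0_has_integral (Pi n.+1) f J.
Proof.
move=> mf f0 HI [mI I0 HJ]; split => //.
rewrite integral_mpowS; first last.
- by move=> t; rewrite lee_fin.
- exact/measurable_EFinP.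
by rewrite -HJ; apply: eq_integral => x _; case: (HI x).
Qed.

Lemma ge0_has_integral_cst n (k : R) : 0 <= k -> ge0_has_integral (Pi n) (fun _ => k) k.
Proof.
move=> k0; split => //.
by rewrite integral_cst//= mpowT mule1.
Qed.

Section indicator_mem_count.
Variable B : set R.
Hypothesis mB : measurable B.
Let e (t : R) : R := \1_B t.
Let p := fine (pi0 B).

Let e_ge0 t : 0 <= e t. Proof. by rewrite /e indicE ler0n. Qed.

Let e_sqr t : e t ^+ 2 = e t.
Proof. by rewrite /e indicE; case: (_ \in _); rewrite ?expr1n ?expr0n. Qed.

Let pi0B_fin : pi0 B \is a fin_num.
Proof.
rewrite ge0_fin_numE//; apply: (@le_lt_trans _ _ 1%E); last exact: ltry.
by rewrite -pi0T; apply: le_measure; rewrite ?inE.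
Qed.

Definition mem_count n (t : n.-tuple R) : R := \sum_(i < n) \1_B (tnth t i).

Lemma mem_count_cons n x (t : n.-tuple R) : mem_count [tuple of x :: t] = e x + mem_count t.
Proof.
rewrite /mem_count big_ord_recl tnth0; congr (_ + _).
by apply: eq_bigr => i _; rewrite tnthS.
Qed.

Lemma mem_count_ge0 n (t : n.-tuple R) : 0 <= mem_count t.
Proof. by apply: sumr_ge0 => i _; exact: e_ge0. Qed.

Lemma measurable_mem_count n : measurable_fun setT (@mem_count n).
Proof.
apply: measurable_sum => i; apply: measurableT_comp; first exact: measurable_indic.
exact: measurable_tnth.
Qed.

Let he : ge0_has_integral pi0 e p.
Proof.
split => //; first exact: measurable_indic.
by rewrite integral_indic// setIT fineK.
Qed.

Let p_ge0 : 0 <= p. Proof. exact: fine_ge0. Qed.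

Let hcst (k : R) : 0 <= k -> ge0_has_integral pi0 (fun _ => k) k.
Proof. by move=> k0; split => //; rewrite integral_cst//= pi0T mule1. Qed.

Lemma mem_count_has_integral n : ge0_has_integral (Pi n) (@mem_count n) (n%:R * p).
Proof.
elim: n => [|n IH].
  rewrite mul0r (_ : @mem_count 0 = fun _ => 0); first exact: ge0_has_integral_cst.
  by apply/funext => t; rewrite /mem_count big_ord0.
apply: (@ge0_has_integral_mpowS _ _ (fun x => e x + n%:R * p)).
- exact: measurable_mem_count.
- exact: mem_count_ge0.
- move=> x; under eq_fun do rewrite mem_count_cons.
  by apply: ge0_has_integralD => //; exact: ge0_has_integral_cst.
- rewrite (_ : n.+1%:R * p = p + n%:R * p); last by rewrite -natr1; ring.
  by apply: ge0_has_integralD => //; apply: hcst; rewrite mulr_ge0.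
Qed.

(** Second moment of a binomial variable; the induction uses that an indicator is its own square. *)
Lemma mem_count_sqr_has_integral n : ge0_has_integral (Pi n) (fun t => mem_count t ^+ 2)
  (n%:R * p + (n%:R * p) ^+ 2 - n%:R * p ^+ 2).
Proof.
elim: n => [|n IH].
  rewrite !mul0r expr0n addr0 subr0 (_ : (fun t => _) = fun _ => 0).
    exact: ge0_has_integral_cst.
  by apply/funext => t; rewrite /mem_count big_ord0 expr0n.
apply: (@ge0_has_integral_mpowS _ _ (fun x => e x + 2 * e x * (n%:R * p) +
   (n%:R * p + (n%:R * p) ^+ 2 - n%:R * p ^+ 2))).
- by apply: measurable_funX; exact: measurable_mem_count.
- by move=> t; exact: sqr_ge0.
- move=> x.
  rewrite (_ : (fun t => _) = fun t : n.-tuple R => e x + 2 * e x * mem_count t + mem_count t ^+ 2).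
    apply: ge0_has_integralD => //; apply: ge0_has_integralD.
      exact: ge0_has_integral_cst.
    by apply: ge0_has_integralZ; [rewrite mulr_ge0|exact: mem_count_has_integral].
  by apply/funext => t; rewrite mem_count_cons -{2}[e x]e_sqr; ring.
- rewrite (_ : n.+1%:R * p + _ - _ = p + (2 * (n%:R * p)) * p +
    (n%:R * p + (n%:R * p) ^+ 2 - n%:R * p ^+ 2)); last by rewrite -natr1; ring.
  apply: ge0_has_integralD; last first.
    apply: hcst; case: IH => _ h0 hI; rewrite -lee_fin -hI.
    by apply: integral_ge0 => t _; rewrite lee_fin.
  apply: ge0_has_integralD => //.
  rewrite (_ : (fun x => _) = fun x => (2 * (n%:R * p)) * e x).
    by apply: ge0_has_integralZ => //; rewrite !mulr_ge0.
  by apply/funext => x; ring.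
Qed.

End indicator_mem_count.

Lemma l0norm_mem_count n (t : n.-tuple R) : (l0norm t)%:R = mem_count (~` [set 0]) t :> R.
Proof.
rewrite /l0norm -sum1_card natr_sum big_mkcond /=; apply: eq_bigr => i _.
rewrite indicE inE; case: eqVneq => [->|ne].
  by rewrite memNset//; apply.
by rewrite mem_set//= => /eqP; rewrite (negbTE ne).
Qed.

Lemma measurable_sparse n s : measurable (@sparse R n s).
Proof.
have -> : @sparse R n s = @mem_count (~` [set 0]) n @^-1` `]-oo, s%:R].
  apply/seteqP; split => t /=; rewrite in_itv /= -l0norm_mem_count ler_nat//.
rewrite -[X in measurable X]setTI; apply: measurable_mem_count => //.
by apply: measurableC; exact: measurable_set1.
Qed.

End counting.

(** * Bounds on the Bayes and minimax risks *)

Section risk_bounds.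
Context {R : realType}.
Variables (r : R) (pi0 : {sigma_finite_measure set R -> \bar R}).
Hypotheses (r0 : 0 < r) (pi0T : pi0 setT = 1%E).
Local Notation Pi n := (mpow pi0 n).

Section upper.
Variables (q : R -> R -> R) (R0 U : R).
Hypothesis mq : measurable_fun setT (fun z : R * R => q z.1 z.2).
Hypothesis q0 : forall x y, 0 < q x y.
Hypothesis q1 : forall x, (\int[lebR]_y (q x y)%:E = 1)%E.
Hypotheses (R0_ge0 : 0 <= R0) (U_ge0 : 0 <= U).
Hypothesis risk0 : (risk1 r 0 q <= R0%:E)%E.
Hypothesis riskU : forall a, (risk1 r a q <= U%:E)%E.

Lemma risk_product_le n (t : n.-tuple R) :
  (risk r t (product_pd q) <= (n%:R * R0 + (l0norm t)%:R * U)%:E)%E.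
Proof.
have -> : n%:R * R0 = \sum_(i < n) R0 by rewrite sumr_const card_ord mulr_natl.
rewrite risk_product// l0norm_mem_count /mem_count mulr_suml -big_split /= -sumEFin.
apply: lee_sum => i _; rewrite indicE.
have [->|ne] := eqVneq (tnth t i) 0.
  by rewrite memNset; [rewrite mul0r addr0|apply].
rewrite mem_set; last by move=> /eqP; rewrite (negbTE ne).
by rewrite mul1r; apply: (le_trans (riskU _)); rewrite lee_fin lerDr.
Qed.

Lemma minimax_risk_le n s :
  (minimax_risk r (sparse n s) <= (n%:R * R0 + s%:R * U)%:E)%E.
Proof.
apply: ge_ereal_inf.
exists (ereal_sup [set risk r t (product_pd q) | t in sparse n s]).
  by exists (product_pd q) => //; exact: product_pdP.
apply: ge_ereal_sup => _ [t /= ts <-].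
apply: (le_trans (risk_product_le t)); rewrite lee_fin lerD2l ler_wpM2r//.
by rewrite ler_nat.
Qed.

(** The risk bound is affine in the number of nonzero coordinates, whose prior mean is at most
    [n * eta]. *)
Lemma bayes_risk_le n eta : ((1 - eta)%:E <= pi0 [set 0%R])%E ->
  (bayes_risk r (Pi n) <= (n%:R * R0 + n%:R * eta * U)%:E)%E.
Proof.
move=> pi00; apply: ge_ereal_inf.
exists (integrated_risk r (Pi n) (product_pd q)).
  by exists (product_pd q) => //; exact: product_pdP.
have mB : measurable (~` [set 0%R : R]) by apply: measurableC; exact: measurable_set1.
have [mc c0 ci] := mem_count_has_integral pi0T mB n.
apply: (@le_trans _ _ (n%:R * R0 + U * (n%:R * fine (pi0 (~` [set 0%R]))))%:E); last first.
  rewrite lee_fin lerD2l mulrC ler_wpM2r// ler_wpM2l//.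
  have fin0 : pi0 [set 0%R] \is a fin_num.
    rewrite ge0_fin_numE//; apply: (@le_lt_trans _ _ 1%E); last exact: ltry.
    by rewrite -pi0T; apply: le_measure; rewrite ?inE.
  have : (pi0 [set 0%R] + pi0 (~` [set 0%R]) = 1)%E.
    by rewrite -pi0T -(setvU [set 0%R]) setUC measureU// setICr.
  rewrite -(fineK fin0) in pi00 *; move: pi00; rewrite lee_fin => pi00.
  case: (pi0 (~` _)) => [c| |]//; rewrite -EFinD => -[] /=; lra.
have hI : ge0_has_integral (Pi n)
    (fun t => n%:R * R0 + U * mem_count (~` [set 0%R]) t)
    (n%:R * R0 + U * (n%:R * fine (pi0 (~` [set 0%R])))).
  apply: ge0_has_integralD; first by apply: ge0_has_integral_cst => //; rewrite mulr_ge0.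
  exact: ge0_has_integralZ.
have [mh h0 <-] := hI.
apply: ge0_le_integralT => [t|||t].
- by apply: risk_ge0 => //; exact: product_pdP.
- by apply: measurable_risk => //; exact: product_pdP.
- exact/measurable_EFinP.
- by rewrite -l0norm_mem_count (mulrC U); exact: risk_product_le.
Qed.

End upper.

Section lower.
Hypothesis pi00 : (0 < pi0 [set 0%R])%E.
Variables (A : set R) (kappa : R).
Hypotheses (mA : measurable A) (A0 : ~ A 0) (kappa_ge0 : 0 <= kappa).
Hypothesis risk_A : forall t, A t -> (kappa%:E <= risk1 r t (bayes_pd r pi0))%E.
Let q := bayes_pd r pi0.

Let mq : measurable_fun setT (fun z : R * R => q z.1 z.2).
Proof. exact: measurable_bayes_pd. Qed.
Let q0 x y : 0 < q x y. Proof. exact: bayes_pd_gt0. Qed.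
Let q1 x : (\int[lebR]_y (q x y)%:E = 1)%E. Proof. exact: integral_bayes_pd. Qed.

Lemma risk_product_ge n (t : n.-tuple R) :
  ((kappa * mem_count A t)%:E <= risk r t (product_pd q))%E.
Proof.
rewrite risk_product// /mem_count mulr_sumr -sumEFin; apply: lee_sum => i _.
rewrite indicE; have [tA|tA] := boolP (_ \in A).
  by rewrite mulr1; apply: risk_A; rewrite inE in tA.
by rewrite mulr0; exact: risk1_ge0.
Qed.

Lemma bayes_risk_ge n :
  ((kappa * (n%:R * fine (pi0 A)) - 1)%:E <= bayes_risk r (Pi n))%E.
Proof.
apply: le_ereal_inf_tmp => _ [phat phatP <-].
have := bayes_lower_bound r0 pi0T pi00 phatP measurableT.
have [mc c0 ci] := ge0_has_integralZ kappa_ge0 (mem_count_has_integral pi0T mA n).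
move=> lower; rewrite EFinB leeBlDr//; apply: le_trans lower.
rewrite -ci; apply: ge0_le_integralT => [t|||t].
- by rewrite lee_fin.
- exact/measurable_EFinP.
- by apply: measurable_risk => //; exact: product_pdP.
- exact: risk_product_ge.
Qed.

(** The supremum over sparse vectors dominates the prior integral over them. Restricting to sparse
    vectors loses, on average, at most [(e ^+ 2)^-1] coordinates in [A], a bound that does not grow
    with [n] or [s]. *)
Lemma minimax_risk_ge n s (e : R) : 0 < e -> (0 < s)%N ->
  n%:R * fine (pi0 (~` [set 0%R])) <= (1 - e) * s%:R ->
  ((kappa * (n%:R * fine (pi0 A) - (e ^+ 2)^-1) - 1)%:E <=
    minimax_risk r (sparse n s))%E.
Proof.
move=> e0 s0 mean_le.
apply: le_ereal_inf_tmp => _ [phat phatP <-].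
set M := ereal_sup _.
have mB : measurable (~` [set 0%R : R]) by apply: measurableC; exact: measurable_set1.
set p := fine (pi0 (~` [set 0%R])) in mean_le *.
have p_ge0 : 0 <= p by exact: fine_ge0.
have sR : 0 < s%:R :> R by rewrite ltr0n.
have mS := @measurable_sparse R n s.
have risk_M t : sparse n s t -> (risk r t phat <= M)%E.
  by move=> ts; apply: ereal_sup_ubound; exists t.
have M_ge0 : (0 <= M)%E.
  apply: le_trans (risk_M [tuple of nseq n 0] _); first exact: risk_ge0.
  rewrite /sparse /= /l0norm (eq_card0 (A := [pred i | _])) => [|i]//.
  by rewrite !inE tnth_nseq eqxx.
have step1 : (\int[Pi n]_(t in sparse n s) risk r t phat <= M)%E.
  apply: (@le_trans _ _ (\int[Pi n]_(t in sparse n s) (cst M t))%E).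
    apply: ge0_le_integral => //.
    - by move=> t _; exact: risk_ge0.
    - by apply: measurable_funTS; exact: measurable_risk.
  rewrite (integral_cst (Pi n) mS M) -[leRHS]mule1.
  apply: lee_wpmul2l => //.
  by rewrite -(mpowT pi0T n); apply: le_measure; rewrite ?inE.
have step2 := bayes_lower_bound r0 pi0T pi00 phatP mS.
(* When [N > s], the bound on the mean [m] gives both [N - m >= e * s] and [N - m >= e * N], so
   [(N - m) ^+ 2 / c >= N]. The average of the left side is at most [m / c <= (e ^+ 2)^-1]. *)
pose c := e ^+ 2 * s%:R.
have c0 : 0 < c by rewrite mulr_gt0// exprn_gt0.
pose m := n%:R * p.
have m_ge0 : 0 <= m by rewrite mulr_ge0.
pose cS (t : n.-tuple R) := mem_count A t * \1_(sparse n s) t.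
have mcS : measurable_fun setT cS.
  apply: measurable_funM; first exact: measurable_mem_count.
  exact: measurable_indic.
have cS0 t : 0 <= cS t by rewrite mulr_ge0 ?mem_count_ge0// indicE.
have step3 : ((kappa%:E * \int[Pi n]_t (cS t)%:E) <=
    \int[Pi n]_(t in sparse n s) risk r t (product_pd q))%E.
  rewrite -ge0_integralTZl//; last exact/measurable_EFinP.
  rewrite [leRHS]integral_mkcond.
  have mr : measurable_fun setT (fun t : n.-tuple R => risk r t (product_pd q)).
    by apply: measurable_risk => //; exact: product_pdP.
  apply: ge0_le_integralT => [t|||t].
  - by rewrite mule_ge0 ?lee_fin.
  - by apply: emeasurable_funM => //; exact/measurable_EFinP.
  - by apply: (measurable_restrictT _ mS).1; exact: measurable_funTS.
  rewrite patchE /cS indicE; case: ifP => ts; last by rewrite mulr0 mule0.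
  by rewrite mulr1 -EFinM risk_product_ge.
(* Integrated form of [mem_count A <= mem_count A * 1_S + (N - m)^2 / c], where
   [N] is the number of nonzero coordinates and [m] its mean. *)
have step4 : ((n%:R * fine (pi0 A) + 2 * m / c * (n%:R * p))%:E <=
    \int[Pi n]_t (cS t)%:E + (c^-1 * (n%:R * p + (n%:R * p) ^+ 2 - n%:R * p ^+ 2) +
      m ^+ 2 / c)%:E)%E.
  have k1 : 0 <= 2 * m / c by rewrite divr_ge0 ?mulr_ge0// ltW.
  have k2 : 0 <= m ^+ 2 / c by rewrite divr_ge0 ?sqr_ge0// ltW.
  have k3 : 0 <= c^-1 by rewrite invr_ge0 ltW.
  have [mf f0 <-] := ge0_has_integralD (mem_count_has_integral pi0T mA n)
    (ge0_has_integralZ k1 (mem_count_has_integral pi0T mB n)).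
  apply: (ge0_has_integral_le (ge0_has_integralD
    (ge0_has_integralZ k3 (mem_count_sqr_has_integral pi0T mB n))
    (ge0_has_integral_cst pi0T n k2))) => //; first exact/measurable_EFinP.
  move=> t; rewrite -EFinD lee_fin.
  set N := mem_count (~` [set 0%R]) t.
  have N_ge0 : 0 <= N by exact: mem_count_ge0.
  have A_le : mem_count A t <= N.
    apply: ler_sum => i _; rewrite !indicE ler_nat.
    have [tA|]//= := boolP (_ \in A); rewrite mem_set// => t0.
    by apply: A0; rewrite inE t0 in tA.
  suff : mem_count A t <= cS t + (N - m) ^+ 2 / c.
    have -> : (N - m) ^+ 2 / c = c^-1 * N ^+ 2 + m ^+ 2 / c - 2 * m / c * N by ring.
    by lra.
  have sq : 0 <= (N - m) ^+ 2 / c by rewrite divr_ge0 ?sqr_ge0// ltW.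
  rewrite /cS indicE; have [ts|ts] := boolP (t \in sparse n s).
    by rewrite mulr1; lra.
  rewrite mulr0 add0r; apply: (le_trans A_le).
  have N_gt : s%:R < N.
    rewrite /N -l0norm_mem_count ltr_nat ltnNge; apply: contra ts => ts.
    by rewrite inE.
  have u_ge : e * s%:R <= N - m by rewrite /m; lra.
  rewrite ler_pdivlMr// /c.
  have es0 : 0 < e * s%:R by rewrite mulr_gt0.
  have h1 : e * (e * s%:R) * N <= e * (N - m) * N.
    by rewrite ler_wpM2r// ler_wpM2l// ltW.
  have e1 : 0 <= 1 - e by rewrite -(pmulr_lge0 _ sR); exact: le_trans mean_le.
  have h2 : (1 - e) * s%:R <= (1 - e) * N by rewrite ler_wpM2l// ltW.
  have h2' : e * N <= N - m by rewrite /m; lra.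
  have h3 : e * N * (N - m) <= (N - m) * (N - m).
    by rewrite ler_wpM2r//; lra.
  by lra.
have : ((kappa * (n%:R * fine (pi0 A) - (e ^+ 2)^-1))%:E <= M + 1)%E.
  apply: le_trans (leeD2r 1%E step1); apply: (le_trans _ step2).
  apply: (le_trans _ step3); rewrite EFinM lee_wpmul2l ?lee_fin//.
  have : (0 <= \int[Pi n]_t (cS t)%:E)%E by apply: integral_ge0 => t _; rewrite lee_fin.
  move: step4; case: (\int[Pi n]_t (cS t)%:E)%E => [X|_ _|//]; last by rewrite leey.
  rewrite -EFinD !lee_fin -/m => step4 _.
  have h4 : c^-1 * m <= (e ^+ 2)^-1.
    rewrite /c invfM -mulrA ler_piMr ?invr_ge0 ?sqr_ge0//.
    rewrite mulrC ler_pdivrMr// mul1r; apply: (le_trans mean_le); nra.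
  have h5 : 0 <= c^-1 * (n%:R * p ^+ 2).
    by apply: mulr_ge0; [rewrite invr_ge0 ltW|apply: mulr_ge0 => //; exact: sqr_ge0].
  by lra.
by rewrite EFinB leeBlDr.
Qed.

End lower.
End risk_bounds.

(** * Choice of constants and passage to the limit *)

Section asymptotics.
Context {R : realType}.
Variable r : R.
Hypothesis r0 : 0 < r.
Let w := 1 - bg_v r.

Lemma expRN_le_inv (u : R) : 0 < u -> expR (- u) <= u^-1.
Proof.
move=> u0; rewrite expRN lef_pV2 ?posrE ?expR_gt0//.
by apply: le_trans (expR_ge1Dx u); lra.
Qed.

Let w_bounds : 0 < w < 1.
Proof. by rewrite /w; have [v0 v1 _] := bg_v_eq r0; apply/andP; split; lra. Qed.

Lemma bigrid_prior_facts z : 0 < z < 1 -> exists2 M : R, 2 <= M & forall L, M <= L ->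
  exists2 pi0 : {sigma_finite_measure set R -> \bar R},
    pi0 = bigrid_prior r (expR (- L)) :> (set R -> \bar R) &
    [/\ pi0 setT = 1%E, ((1 - expR (- L))%:E <= pi0 [set 0%R])%E &
      exists A : set R, [/\ measurable A, ~ A 0,
        (forall t, A t ->
          ((w * (1 - z / 4) * L)%:E <= risk1 r t (bayes_pd r pi0))%E) &
        expR (- L) * (1 - z / 8) <= fine (pi0 A)]].
Proof.
move=> /andP[z0 z1]; have /andP[w0 w1] := w_bounds.
have v0 := bg_v_gt0 r0; have b0 := bg_b_gt0 r0.
set vb := bg_v r * bg_b r ^+ 2.
have vb0 : 0 < vb by rewrite mulr_gt0// exprn_gt0.
(* The slope loses [e] and the constant [C] costs at most another [e * L]: together
   [2 * e = w * z / 4]. *)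
pose e := w * z / 8; have e0 : 0 < e by rewrite divr_gt0// mulr_gt0.
have [C C0 HC] := risk1_bayes_ge r0 e0.
pose k : R := (bg_K r).+1%:R.
have k1 : 1 <= k by rewrite ler1n.
have zvb0 : 0 < z * vb by rewrite mulr_gt0.
have M10 : 0 <= C / e by rewrite divr_ge0// ltW.
have M20 : 0 <= 8 * k / (z * vb) by apply: divr_ge0; [lra|exact: ltW].
(* The summands ensure in turn [expR (- L) <= 2^-1], [C <= e * L] and, through [expR (- u) <= u^-1],
   that the relative mass lost off the two points is at most [z / 8]. *)
exists (2 + C / e + 8 * k / (z * vb)); first by lra.
move=> L LM.
have L2 : 2 <= L by lra.
have L0 : 0 <= L by lra.
have Lgt0 : 0 < L by lra.
have LC : C <= e * L by rewrite mulrC -ler_pdivrMr//; lra.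
have vbL : 8 * k <= z * (vb * L).
  by rewrite mulrA (mulrC _ L) -ler_pdivrMr//; lra.
have eL2 : expR (- L) <= 2^-1.
  by apply: (le_trans (expRN_le_inv Lgt0)); rewrite lef_pV2 ?posrE.
set x := expR (- (bg_v r * bg_b r ^+ 2 * L)).
have kx : k * x <= z / 8.
  have vbL0 : 0 < vb * L by rewrite mulr_gt0.
  have xle : x <= (vb * L)^-1 by exact: expRN_le_inv.
  apply: (@le_trans _ _ (k * (vb * L)^-1)); first by rewrite ler_wpM2l//; lra.
  by rewrite ler_pdivrMr//; lra.
have x0 : 0 <= x by exact: expR_ge0.
have x2 : x <= 2^-1.
  have : 1 * x <= k * x by rewrite ler_wpM2r.
  by lra.
have [pi0 piE] := bigrid_prior_sigma_finite r0 L0 x2.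
have piT : pi0 setT = 1%E by rewrite piE (bigrid_priorT r0 L0 x2).
have pi00 : ((1 - expR (- L))%:E <= pi0 [set 0%R])%E by rewrite piE (bigrid_prior0 r L0).
exists pi0 => //; split => //.
set l := bg_lambda r (expR (- L)).
have lsq : l ^+ 2 = 2 * bg_v r * L := bg_lambda_sqr r0 L0.
have mA : measurable ([set l] `|` [set - l] : set R).
  by apply: measurableU; exact: measurable_set1.
have piA_fin : pi0 ([set l] `|` [set - l]) \is a fin_num.
  rewrite ge0_fin_numE//; apply: (@le_lt_trans _ _ 1%E); last exact: ltry.
  by rewrite -piT; apply: le_measure; rewrite ?inE.
have Asq t : ([set l] `|` [set - l]) t -> t ^+ 2 = 2 * bg_v r * L.
  by move=> [->|->]; rewrite ?sqrrN.
exists ([set l] `|` [set - l]); split => //.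
- move=> /Asq; rewrite expr0n /= => /esym/eqP.
  by rewrite gt_eqF// !mulr_gt0.
- move=> t /Asq tsq; apply: le_trans (HC pi0 L t piT L0 eL2 pi00 tsq).
  by rewrite lee_fin -/w; move: LC; rewrite /e; lra.
- rewrite -lee_fin fineK// piE.
  apply: le_trans (bigrid_prior_lambda r0 L0 x2 _ _); last 2 first.
  + by left.
  + by right.
  by rewrite lee_fin ler_wpM2l ?expR_ge0// -/x -/k; lra.
Qed.

Lemma upper_bounds z : 0 < z < 1 -> exists2 M : R, 2 <= M & forall (n s : nat) L,
  M <= L -> n%:R * expR (- L) = s%:R ->
  (minimax_risk r (sparse n s) <= ((1 + z) * (w * L * s%:R))%:E)%E /\
  forall pi0 : {sigma_finite_measure set R -> \bar R}, pi0 setT = 1%E ->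
    ((1 - expR (- L))%:E <= pi0 [set 0%R])%E ->
    (bayes_risk r (mpow pi0 n) <= ((1 + z) * (w * L * s%:R))%:E)%E.
Proof.
move=> /andP[z0 z1]; have /andP[w0 w1] := w_bounds.
have v0 := bg_v_gt0 r0.
(* The allowed excess [z * w * L] is [2 * d * L]: one [d * L] goes to the slope of the hybrid risk,
   half of the other to the risk at 0, and the last half to the constants. *)
pose d := z * w / 2.
have zw : z * w < 1 by apply: (@lt_trans _ _ z) => //; rewrite gtr_pMr.
have zw' : z * w < w by rewrite gtr_pMl.
have d0 : 0 < d by rewrite divr_gt0// mulr_gt0.
have d1 : d < 1 by rewrite /d; lra.
have dv : (1 + d) * bg_v r <= 1.
  have : d * bg_v r <= d * 1 by rewrite ler_wpM2l ?(ltW d0)//; rewrite /w in w0; lra.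
  by move: zw' w0; rewrite /d /w; lra.
have [C C0 HC] := risk1_hybrid_le r0 d0 d1 dv.
have pi0 := @pi_gt0 R.
pose delta := d / (4 * pi).
have delta0 : 0 < delta by rewrite divr_gt0// mulr_gt0.
pose D1 := delta^-1 * expR 1 ^+ 2.
have D10 : 0 <= D1 by rewrite mulr_ge0 ?sqr_ge0// invr_ge0 ltW.
have M10 : 0 <= 2 * (D1 + C) / d by apply: divr_ge0; [lra|exact: ltW].
exists (2 + 2 * (D1 + C) / d); first by lra.
move=> n s L LM nL.
have L2 : 2 <= L by lra.
have L0 : 0 <= L by lra.
have Ld : 2 * (D1 + C) <= d * L by rewrite (mulrC d) -ler_pdivrMr//; lra.
have e0 : 0 < expR (- L) by exact: expR_gt0.
have s0 : 0 <= s%:R :> R by exact: ler0n.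
set U := (1 - bg_v r + d) * L + C.
set R0 := 2 * expR (1 - L) * Num.sqrt (L * pi *+ 2).
have U0 : 0 <= U by apply: addr_ge0 => //; apply: mulr_ge0 => //; rewrite -/w; lra.
have R00 : 0 <= R0 by rewrite /R0 mulr_ge0 ?sqrtr_ge0// mulr_ge0// expR_ge0.
have main : n%:R * R0 + s%:R * U <= (1 + z) * (w * L * s%:R).
  set S := Num.sqrt (L * pi *+ 2) in R0 R00 *.
  have S2 : S ^+ 2 = L * pi *+ 2.
    by rewrite sqr_sqrtr// mulrn_wge0// mulr_ge0// ltW.
  (* Since [n * expR (- L) = s], all the zero coordinates together cost only order [s] times the
     square root of [L]. The value of [delta] turns this into [d * L / 2] plus a constant, per unit
     of [s]. *)
  have -> : n%:R * R0 = s%:R * (2 * S * expR 1).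
    by rewrite /R0 expRD -nL; ring.
  have am := amgm_delta S (expR 1) delta0.
  have dS : delta * S ^+ 2 = d * L / 2.
    have gen (P : R) : 0 < P -> d / (4 * P) * (L * P *+ 2) = d * L / 2.
      by move=> P0; field; rewrite gt_eqF.
    by rewrite S2 gen.
  rewrite -mulrDr (mulrC (w * L)) (mulrCA (1 + z)); apply: ler_wpM2l => //.
  rewrite /U -/w; move: am Ld; rewrite dS -/D1 /d; lra.
have h0 := risk1_hybrid0 r0 L2; have hU a := HC L a L0.
split=> [|pi1 piT pi00].
  apply: (@le_trans _ _ (n%:R * R0 + s%:R * U)%:E); last by rewrite lee_fin.
  exact: (minimax_risk_le r0 (measurable_hybrid_pd r0 e0) (hybrid_pd_gt0 r0 e0)
    (integral_hybrid_pd r0 e0)).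
apply: (@le_trans _ _ (n%:R * R0 + n%:R * expR (- L) * U)%:E).
  exact: (bayes_risk_le r0 piT (measurable_hybrid_pd r0 e0) (hybrid_pd_gt0 r0 e0)
    (integral_hybrid_pd r0 e0)).
by rewrite lee_fin nL main.
Qed.

Lemma lower_bounds z : 0 < z < 1 -> exists2 M : R, 2 <= M & forall (n s : nat) L,
  M <= L -> M <= s%:R -> n%:R * expR (- L) = s%:R ->
  (((1 - z) * (w * L * s%:R))%:E <= minimax_risk r (sparse n s))%E /\
  exists pi0 : {sigma_finite_measure set R -> \bar R},
    [/\ pi0 = bigrid_prior r (expR (- L)) :> (set R -> \bar R), pi0 setT = 1%E,
    ((1 - expR (- L))%:E <= pi0 [set 0%R])%E &
    (((1 - z) * (w * L * s%:R))%:E <= bayes_risk r (mpow pi0 n))%E].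
Proof.
move=> z01; have /andP[z0 z1] := z01; have /andP[w0 w1] := w_bounds.
have [M M2 HM] := bigrid_prior_facts z01.
pose e := z / 8; have e0 : 0 < e by rewrite divr_gt0.
have e1 : e < 1 by rewrite /e; lra.
have zw : 0 < z * w by rewrite mulr_gt0.
have N1 : 0 <= 8 / (3 * (z * w)) by rewrite divr_ge0// mulr_ge0// ltW.
have N2 : 0 <= (e ^+ 2)^-1 / e by rewrite divr_ge0 ?invr_ge0 ?sqr_ge0// ltW.
(* For the minimax risk the loss [z] is shared out as [z / 4] in [kappa], [3 * z / 8] in the count
   (reduced sparsity, mass off the two points, Chebyshev term) and [3 * z / 8] for the additive 1.
   The last two summands make the additive 1 and the Chebyshev term fit. *)
exists (M + 8 / (3 * (z * w)) + (e ^+ 2)^-1 / e); first by lra.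
move=> n s L ML Ms nL.
have s2 : 1 <= s%:R :> R by lra.
have s0 : (0 < s)%N by rewrite -(ltr0n R); lra.
have L0 : 0 < L by lra.
pose kappa := w * (1 - z / 4) * L.
have kappa0 : 0 <= kappa by apply: mulr_ge0; [apply: mulr_ge0; lra|exact: ltW].
have small : 1 <= 3 * z / 8 * (w * L * s%:R).
  have h : 8 <= L * (3 * (z * w)) by rewrite -ler_pdivrMr ?mulr_gt0//; lra.
  have : L * (3 * (z * w)) * 1 <= L * (3 * (z * w)) * s%:R.
    by rewrite ler_wpM2l//; lra.
  by lra.
have wLs : 0 <= w * L * s%:R.
  by apply: mulr_ge0; [apply: mulr_ge0; exact: ltW|lra].
have se : (e ^+ 2)^-1 <= e * s%:R by rewrite (mulrC e) -ler_pdivrMr//; lra.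
split.
  (* The level of the prior of sparsity [(1 - e) * s / n]; as [L <= L'], risk bounds at level [L']
     imply those at [L]. *)
  pose L' := L - ln (1 - e).
  have lne0 : ln (1 - e) <= 0 by rewrite ln_le0//; lra.
  have eL' : expR (- L') = expR (- L) * (1 - e).
    by rewrite /L' opprB addrC expRD lnK ?posrE//; lra.
  have ML' : M <= L' by rewrite /L'; lra.
  have [pi1 pi1E [piT pi00 [A [mA A0 HA piA]]]] := HM L' ML'.
  have pi00' : (0 < pi1 [set 0%R])%E.
    apply: lt_le_trans pi00; rewrite lte_fin subr_gt0 -expR0 ltr_expR; lra.
  have HA' t : A t -> (kappa%:E <= risk1 r t (bayes_pd r pi1))%E.
    move=> /HA; apply: le_trans; rewrite lee_fin /kappa ler_wpM2l//.
      by apply: mulr_ge0; lra.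
    by rewrite /L'; lra.
  apply: le_trans (minimax_risk_ge r0 piT pi00' mA A0 kappa0 HA' e0 s0 _).
    rewrite lee_fin.
    have nA : s%:R * (1 - e) * (1 - z / 8) <= n%:R * fine (pi1 A).
      rewrite -nL -mulrA -mulrA ler_wpM2l//.
      by rewrite mulrA -eL'.
    have h1 : s%:R * (1 - 3 * z / 8) <= n%:R * fine (pi1 A) - (e ^+ 2)^-1.
      have : 0 <= z * z * s%:R by apply: mulr_ge0; [apply: mulr_ge0; exact: ltW|lra].
      by move: nA se; rewrite /e; lra.
    have h2 := ler_wpM2l kappa0 h1.
    have : 0 <= z * z * (w * L * s%:R).
    by apply: mulr_ge0 => //; apply: mulr_ge0; exact: ltW.
    by move: h2 small; rewrite /kappa; lra.
  have fin0 : pi1 [set 0%R] \is a fin_num.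
    rewrite ge0_fin_numE//; apply: (@le_lt_trans _ _ 1%E); last exact: ltry.
    by rewrite -piT; apply: le_measure; rewrite ?inE.
  have : (pi1 [set 0%R] + pi1 (~` [set 0%R]) = 1)%E.
    rewrite -piT -(setvU [set 0%R]) setUC measureU// ?setICr//.
    by apply: measurableC; exact: measurable_set1.
  rewrite -(fineK fin0) in pi00 *; move: pi00; rewrite lee_fin => pi00.
  case: (pi1 (~` _)) => [c| |]//; rewrite -EFinD => -[] /= hc.
  have : n%:R * c <= n%:R * expR (- L') by rewrite ler_wpM2l//; lra.
  by rewrite eL' mulrA nL; lra.
have ML' : M <= L by lra.
have [pi1 pi1E [piT pi00 [A [mA A0 HA piA]]]] := HM L ML'.
exists pi1; split => //.
have pi00' : (0 < pi1 [set 0%R])%E.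
  apply: lt_le_trans pi00; rewrite lte_fin subr_gt0 -expR0 ltr_expR; lra.
apply: le_trans (bayes_risk_ge r0 piT pi00' mA kappa0 HA n).
rewrite lee_fin.
have nA : s%:R * (1 - z / 8) <= n%:R * fine (pi1 A).
  by rewrite -nL -mulrA ler_wpM2l.
have h2 := ler_wpM2l kappa0 nA.
have : 0 <= z * z * (w * L * s%:R).
    by apply: mulr_ge0 => //; apply: mulr_ge0; exact: ltW.
by move: h2 small; rewrite /kappa; lra.
Qed.

End asymptotics.

(** The same [T], namely [(1 - v) * L * s] with [L = - ln (s / n)], serves both risks, so comparing
    them needs no further asymptotics. *)
Lemma risk_sandwich (R : realType) (r z : R) : 0 < r -> 0 < z < 1 ->
  exists2 M : R, 0 < M & forall n s : nat, (0 < n)%N -> (0 < s)%N -> M <= s%:R ->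
    (s%:R / n%:R : R) <= expR (- M) ->
  exists2 T : R, 0 < T &
    let bounded x := ((((1 - z) * T)%:E <= x)%E && (x <= ((1 + z) * T)%:E)%E) in
    bounded (minimax_risk r (sparse n s)) /\
    bounded (bayes_risk r (measure_power (bigrid_prior r (s%:R / n%:R)) n)).
Proof.
move=> r0 z01.
have [M1 M12 H1] := upper_bounds r0 z01; have [M2 M22 H2] := lower_bounds r0 z01.
exists (M1 + M2); first by lra.
move=> n s n0 s0 Ms sn.
have s1 : 0 < s%:R :> R by rewrite ltr0n.
have n1 : 0 < n%:R :> R by rewrite ltr0n.
have sn0 : 0 < s%:R / n%:R :> R by rewrite divr_gt0.
pose L : R := - ln (s%:R / n%:R).
have eL : expR (- L) = s%:R / n%:R by rewrite opprK lnK.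
have ML : M1 + M2 <= L.
  by rewrite /L lerNr -[leRHS]expRK ler_ln ?posrE// expR_gt0.
have L0 : 0 < L by lra.
have [_ v1 _] := bg_v_eq r0.
have nL : n%:R * expR (- L) = s%:R :> R by rewrite eL mulrC divfK// gt_eqF.
have M1L : M1 <= L by lra.
have M2L : M2 <= L by lra.
have M2s : M2 <= s%:R by lra.
have [up upB] := H1 n s L M1L nL.
have [low [pi0 [piE piT pi00 lowB]]] := H2 n s L M2L M2s nL.
exists ((1 - bg_v r) * L * s%:R); first by rewrite !mulr_gt0// subr_gt0.
rewrite -eL -piE mpowE /=; split; apply/andP; split => //.
exact: upB.
Qed.

Theorem theorem1p3 (R : realType) (r : R) (s : nat -> nat)
    (r_gt0 : 0 < r)
    (s_range : forall n : nat, (1 <= n)%N -> (1 <= s n <= n)%N)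
    (s_infty : s n @[n --> \oo] --> \oo)
    (s_sparse : ((s n)%:R / n%:R : R) @[n --> \oo] --> (0 : R)) :
  exists o : nat -> R,
    o n @[n --> \oo] --> (0 : R) /\
    \forall n \near \oo,
      bayes_risk r
        (measure_power (bigrid_prior r ((s n)%:R / n%:R)) n) =
      (minimax_risk r (sparse n (s n)) * (1 + o n)%:E)%E.
Proof.
pose B n := bayes_risk r (measure_power (bigrid_prior r ((s n)%:R / n%:R)) n).
pose V n := minimax_risk r (sparse n (s n)).
have near_bounds z : 0 < z < 1 -> \forall n \near \oo, exists2 T : R, 0 < T &
    ((((1 - z) * T)%:E <= V n)%E && (V n <= ((1 + z) * T)%:E)%E) /\
    ((((1 - z) * T)%:E <= B n)%E && (B n <= ((1 + z) * T)%:E)%E).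
  move=> z01; have [M M0 HM] := risk_sandwich r_gt0 z01.
  near=> n.
  have n1 : (1 <= n)%N by near: n; exact: nbhs_infty_gt.
  have /andP[s1 sn] := s_range n n1.
  apply: HM => //.
  - apply: (@le_trans _ _ (Num.truncn M).+1%:R).
      by rewrite ltW// truncnS_gt.
    rewrite ler_nat; near: n.
    exact: (s_infty _ (nbhs_infty_ge _)).
  - apply/ltW; near: n.
    have := s_sparse; move/cvgrPdist_lt => /(_ _ (expR_gt0 (- M))).
    apply: filterS => n; rewrite sub0r normrN; apply: le_lt_trans.
    exact: ler_norm.
have fin z n : 0 < z < 1 -> (exists2 T : R, 0 < T &
    ((((1 - z) * T)%:E <= V n)%E && (V n <= ((1 + z) * T)%:E)%E) /\
    ((((1 - z) * T)%:E <= B n)%E && (B n <= ((1 + z) * T)%:E)%E)) ->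
    [/\ V n \is a fin_num, B n \is a fin_num, 0 < fine (V n) &
      `|fine (B n) / fine (V n) - 1| <= 2 * z / (1 - z)].
  move=> /andP[z0 z1] [T T0 [/andP[v1 v2] /andP[b1 b2]]].
  move: v1 v2 b1 b2; case: (V n) => [v| |]//; case: (B n) => [b| |]//.
  rewrite !lee_fin /= => v1 v2 b1 b2.
  have z10 : 0 < (1 - z) * T by rewrite mulr_gt0// subr_gt0.
  have v0 : 0 < v by lra.
  split => //.
  have -> : b / v - 1 = (b - v) / v by field; rewrite gt_eqF.
  rewrite normrM normfV (gtr0_norm v0) ler_pdivrMr//.
  (* Both values lie in an interval of length [2 * z * T], and [T] is at most [v / (1 - z)]. *)
  have : `|b - v| <= 2 * z * T by rewrite ler_norml; apply/andP; split; lra.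
  move=> bv; apply: (le_trans bv).
  have -> : 2 * z / (1 - z) * v = 2 * z * (v / (1 - z)).
    by field; rewrite gt_eqF// subr_gt0.
  apply: ler_wpM2l; first by lra.
  by rewrite ler_pdivlMr ?subr_gt0// mulrC.
(* The relative error; it is meaningful once both risks are finite and [V n] is positive, which
   holds eventually. *)
exists (fun n => fine (B n) / fine (V n) - 1); split.
  apply/cvgrPdist_le => e e0.
  (* With [z <= 2^-1], the error [2 * z / (1 - z)] is at most [4 * z <= e]. *)
  pose z := Num.min (2^-1) (e / 4).
  have z01 : 0 < z < 1.
    by rewrite lt_min invr_gt0 ltr0n divr_gt0//= gt_min invf_lt1 ?ltr1n.
  have ze : 2 * z / (1 - z) <= e.
    have z1 : z <= 2^-1 by rewrite ge_min lexx.
    have z2 : z <= e / 4 by rewrite ge_min lexx orbT.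
    rewrite ler_pdivrMr; last by lra.
    have : e * z <= e * 2^-1 by rewrite ler_wpM2l// ltW.
    by lra.
  have := near_bounds z z01; apply: filterS => n /(fin z n z01)[_ _ _ H].
  by rewrite sub0r normrN (le_trans H).
(* Any [z] in the open unit interval would do: only finiteness and positivity are needed for the
   equality. *)
have z01 : 0 < (2^-1 : R) < 1 by rewrite invr_gt0 ltr0n invf_lt1 ?ltr1n.
have := near_bounds _ z01; apply: filterS => n /(fin _ n z01)[Vf Bf v0 _].
rewrite -/(B n) -/(V n) -{1}(fineK Bf) -(fineK Vf) -EFinM /=; congr EFin.
by field; rewrite gt_eqF.
Unshelve. all: by end_near.
Qed.
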